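(* Let $m\ge 2$ and $q\ge 2$ be integers and let $A$ be a primitive $m\times m$ matrix with entries in $\{0,1\}$. Let $$X_A := \{(x_k)_{k=1}^\infty:\ x_k\in\{0,\dots,m-1\},\ A(x_k,x_{qk})=1 \text{ for all } k\ge 1\}\subset\Sigma_m.$$ (i) We have $$\dim_H(X_A) = \frac{q-1}{q}\log_m \sum_{i=0}^{m-1} t_i,$$ where $(t_i)_{i=0}^{m-1}$ is the unique vector with $t_i>1$ and $t_i^q=\sum_{j=0}^{m-1}A(i,j)t_j$ for all $i$. (ii) The Minkowski dimension of $X_A$ exists and equals $$\dim_M(X_A) = (q-1)^2\sum_{k=1}^\infty \frac{\log_m (A^{k-1}\overline{1},\overline{1})}{q^{k+1}},$$ where $\overline{1}=(1,\dots,1)^T\in\mathbb{R}^m$ and $(\cdot,\cdot)$ is the standard inner product. Moreover, $\dim_H(X_A)=\dim_M(X_A)$ if and only if $\overline{1}$ is an eigenvector of $A$ (i.e. all row sums of $A$ are equal).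
   Context: $\Sigma_m=\{0,\dots,m-1\}^{\mathbb N}$ with the metric $\varrho((x_k),(y_k)) = m^{-\min\{n:\ x_n\ne y_n\}+1}$; Hausdorff and Minkowski dimensions are taken with respect to this metric. A non-negative matrix is primitive if some power is strictly positive. $\log_m$ denotes logarithm to base $m$. *)

(* Defs.v *)
From Stdlib Require Import Reals Lra Lia Arith.
Open Scope R_scope.

(* Points of Sigma_m are sequences x : nat -> nat, 0-based:
   x j stands for the paper's x_{j+1}. *)
Definition in_Sigma (m : nat) (x : nat -> nat) : Prop := forall j, (x j < m)%nat.

(* rho x y d : the paper's metric  rho(x,y) = m^{-min{n : x_n <> y_n} + 1}
   (1-based n), i.e. m^{-j} with j the first 0-based index of difference;
   rho(x,x) = 0.  Stated as a (functional) relation. *)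
Definition rho (m : nat) (x y : nat -> nat) (d : R) : Prop :=
  ((forall j, x j = y j) /\ d = 0) \/
  (exists n, (forall j, (j < n)%nat -> x j = y j) /\ x n <> y n /\ d = (/ INR m) ^ n).

Definition diam_le (m : nat) (U : (nat -> nat) -> Prop) (r : R) : Prop :=
  forall x y, U x -> U y -> forall d, rho m x y d -> d <= r.

Definition pw (r s : R) : R := if Req_EM_T r 0 then 0 else Rpower r s.

(* H^s(E) = 0 : for every delta > 0, H^s_delta(E) = 0, i.e. for every
   eps > 0 there is a countable delta-cover (U_i) of E with sum diam(U_i)^s < eps.
   (r i is an upper bound for diam(U_i); taking r i = diam U_i shows this is the
   same infimum.) *)
Definition Hnull (m : nat) (s : R) (E : (nat -> nat) -> Prop) : Prop :=
  forall delta eps, 0 < delta -> 0 < eps ->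
  exists (U : nat -> (nat -> nat) -> Prop) (r : nat -> R),
    (forall i, 0 <= r i <= delta /\ (forall x, U i x -> in_Sigma m x) /\ diam_le m (U i) (r i)) 
    /\ (forall x, E x -> exists i, U i x)
    /\ (forall N, sum_f_R0 (fun i => pw (r i) s) N < eps).

Definition HausdorffDim (m : nat) (E : (nat -> nat) -> Prop) (d : R) : Prop :=
  (forall s, 0 < s -> Hnull m s E -> d <= s) /\
  (forall e, 0 < e -> exists s, 0 < s /\ Hnull m s E /\ s < d + e).

Definition covers_fin (m : nat) (E : (nat -> nat) -> Prop) (delta : R) (k : nat) : Prop :=
  exists U : nat -> (nat -> nat) -> Prop,
    (forall i, (i < k)%nat -> (forall x, U i x -> in_Sigma m x) /\ diam_le m (U i) delta)
    /\ (forall x, E x -> exists i, (i < k)%nat /\ U i x).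

Definition Ncover (m : nat) (E : (nat -> nat) -> Prop) (delta : R) (k : nat) : Prop :=
  covers_fin m E delta k /\ (forall k', covers_fin m E delta k' -> (k <= k')%nat).

Definition MinkowskiDim (m : nat) (E : (nat -> nat) -> Prop) (d : R) : Prop :=
  forall eps, 0 < eps -> exists delta0, 0 < delta0 /\
    forall delta, 0 < delta < delta0 ->
      exists k, Ncover m E delta k /\ Rabs (ln (INR k) / (- ln delta) - d) < eps.

Fixpoint nsum (n : nat) (f : nat -> nat) : nat :=
  match n with O => O | S n' => (nsum n' f + f n')%nat end.
Fixpoint rsum (n : nat) (f : nat -> R) : R :=
  match n with O => 0 | S n' => rsum n' f + f n' end.

Fixpoint mpow (m : nat) (A : nat -> nat -> nat) (p : nat) : nat -> nat -> nat :=
  match p with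
  | O => fun i j => if Nat.eqb i j then 1%nat else 0%nat
  | S p' => fun i j => nsum m (fun l => (mpow m A p' i l * A l j)%nat)
  end.

Definition zero_one (m : nat) (A : nat -> nat -> nat) : Prop :=
  forall i j, (i < m)%nat -> (j < m)%nat -> A i j = 0%nat \/ A i j = 1%nat.

Definition primitive_mx (m : nat) (A : nat -> nat -> nat) : Prop :=
  exists p, forall i j, (i < m)%nat -> (j < m)%nat -> (0 < mpow m A p i j)%nat.

(* X_A = { x in Sigma_m : A(x_k, x_{qk}) = 1 for all k >= 1 }  (1-based x_k = x (k-1)) *)
Definition X_A (m q : nat) (A : nat -> nat -> nat) (x : nat -> nat) : Prop :=
  in_Sigma m x /\ forall k, (1 <= k)%nat -> A (x (k - 1)%nat) (x (q * k - 1)%nat) = 1%nat.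

Definition logm (m : nat) (x : R) : R := ln x / ln (INR m).

(* (A^n 1, 1) = sum of all entries of A^n *)
Definition ones_form (m : nat) (A : nat -> nat -> nat) (n : nat) : nat :=
  nsum m (fun i => nsum m (fun j => mpow m A n i j)).

Definition t_vec (m q : nat) (A : nat -> nat -> nat) (t : nat -> R) : Prop :=
  forall i, (i < m)%nat -> 1 < t i /\ t i ^ q = rsum m (fun j => INR (A i j) * t j).

(* Main.v *)
Require Import Defs.
From Stdlib Require Import Reals Lra Lia Arith List ClassicalEpsilon Psatz.
Open Scope R_scope.

(** Every k >= 1 is uniquely i * q^j with q not dividing i, so a point of X_A is a family of
    independent A-chains, one on each such progression.

    Hausdorff dimension.  Give the chains the Markov law with initial vector t_a / T, where
    T = sum t_i, and transitions A(i,a) t_a / t_i^q.  With S_n the sum of ln t_(x_k) over k <= n,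
    the cylinder of x of length n has mass given by
    ln P_n(x) = - (n - n/q) ln T + S_n - q S_(n/q).  The averages S_(q^j) / q^j are bounded, hence
    among boundedly many consecutive scales q^j one has P_n(x) >= m^(-n (d + eps)), and the
    cylinders with this property form a finite cover: dim_H <= d.  Conversely S_n minus its
    compensator is a martingale with bounded increments, and the compensator is again a letter
    sum at scale n/q, so iterating the exponential bound shows that S_n / n concentrates; the
    cylinders of mass > m^(-n (d - eps)) therefore have summable total mass, and the mass
    distribution principle, applied to a finite subcover, gives dim_H >= d.

    Minkowski dimension.  Summing out the letters with index in (n/q, n] relates the number of
    admissible words of length n to a weighted count of words of length n/q, whence
    ln N_n / n -> (q-1)^2 sum_k ln a_k / q^(k+2) with a_k = (A^k 1, 1).

    Equality.  With w_k the column sums of A^k, the power mean inequality gives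
    (w_k . t)^q <= a_k^(q-1) (w_(k+1) . t); iterating from w_0 . t = T yields dim_H <= dim_M,
    with equality forced at k = 0 only if t, hence the row sums, are constant. *)

(** * Finite sums *)

(** No measure on the sequence space is built. Both halves run on one finite object, the weighted
    sum [wsum] over words: unit initial weights and transitions [A] count admissible words,
    stochastic weights give expectations. The mass distribution principle therefore has to be
    applied to finitely many cylinders, which is why compactness enters, through [finite_subcover].
    The equation for t has two effects. It makes the transitions stochastic, and it puts the power q
    into the mass of a cylinder, so that the mass depends on the letters only through S_n - q
    S_(n/q). If S_n is close to n L and S_(n/q) to (n/q) L, this difference is small compared with n
    whatever L is. So L is never computed and may depend on the precision; no stationary law or
    ergodic theorem is invoked. The exponential form of the concentration makes the bad masses
    summable over all lengths, as one cover mixes cylinders of different lengths. *)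

Fixpoint lsum {T : Type} (l : list T) (F : T -> R) : R :=
  match l with nil => 0 | a :: l' => F a + lsum l' F end.

Lemma lsum_ext {T} (l : list T) F G :
  (forall x, In x l -> F x = G x) -> lsum l F = lsum l G.
Proof.
  induction l as [|a l IH]; simpl; intros H; [reflexivity|].
  rewrite H by auto. rewrite IH by auto. reflexivity.
Qed.

Lemma lsum_le {T} (l : list T) F G :
  (forall x, In x l -> F x <= G x) -> lsum l F <= lsum l G.
Proof.
  induction l as [|a l IH]; simpl; intros H; [lra|].
  pose proof (H a (or_introl eq_refl)).
  assert (lsum l F <= lsum l G) by auto. lra.
Qed.

Lemma lsum_nonneg {T} (l : list T) F :
  (forall x, In x l -> 0 <= F x) -> 0 <= lsum l F.
Proof.
  induction l as [|a l IH]; simpl; intros H; [lra|].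
  pose proof (H a (or_introl eq_refl)).
  assert (0 <= lsum l F) by auto. lra.
Qed.

Lemma lsum_plus {T} (l : list T) F G :
  lsum l (fun x => F x + G x) = lsum l F + lsum l G.
Proof. induction l as [|a l IH]; simpl; [lra|]. rewrite IH. lra. Qed.

Lemma lsum_scal {T} (l : list T) c F :
  lsum l (fun x => c * F x) = c * lsum l F.
Proof. induction l as [|a l IH]; simpl; [lra|]. rewrite IH. lra. Qed.

Lemma lsum_app {T} (l l' : list T) F : lsum (l ++ l') F = lsum l F + lsum l' F.
Proof. induction l as [|a l IH]; simpl; [lra|]. rewrite IH. lra. Qed.

Lemma lsum_map {T U} (g : T -> U) (l : list T) F :
  lsum (map g l) F = lsum l (fun x => F (g x)).
Proof. induction l as [|a l IH]; simpl; [reflexivity|]. rewrite IH. reflexivity. Qed.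

Lemma lsum_flat_map {T U} (g : T -> list U) (l : list T) F :
  lsum (flat_map g l) F = lsum l (fun x => lsum (g x) F).
Proof.
  induction l as [|a l IH]; simpl; [reflexivity|]. rewrite lsum_app, IH. reflexivity.
Qed.

Lemma lsum_swap {T U} (l : list T) (l' : list U) (F : T -> U -> R) :
  lsum l (fun x => lsum l' (F x)) = lsum l' (fun y => lsum l (fun x => F x y)).
Proof.
  induction l as [|a l IH]; simpl.
  - induction l' as [|b l' IH']; simpl; lra.
  - rewrite IH, <- lsum_plus. reflexivity.
Qed.

Lemma rsum_lsum n f : rsum n f = lsum (seq 0 n) f.
Proof.
  induction n as [|n IH]; [reflexivity|].
  rewrite seq_S, lsum_app. simpl. rewrite IH. lra.
Qed.

Lemma rsum_ext n f g : (forall i, (i < n)%nat -> f i = g i) -> rsum n f = rsum n g.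
Proof.
  intros H. rewrite !rsum_lsum. apply lsum_ext. intros x Hx.
  apply in_seq in Hx. apply H. lia.
Qed.

Lemma rsum_le n f g : (forall i, (i < n)%nat -> f i <= g i) -> rsum n f <= rsum n g.
Proof.
  intros H. rewrite !rsum_lsum. apply lsum_le. intros x Hx.
  apply in_seq in Hx. apply H. lia.
Qed.

Lemma rsum_nonneg n f : (forall i, (i < n)%nat -> 0 <= f i) -> 0 <= rsum n f.
Proof.
  intros H. rewrite rsum_lsum. apply lsum_nonneg. intros x Hx.
  apply in_seq in Hx. apply H. lia.
Qed.

Lemma rsum_plus n f g : rsum n (fun i => f i + g i) = rsum n f + rsum n g.
Proof. rewrite !rsum_lsum. apply lsum_plus. Qed.

Lemma rsum_scal n c f : rsum n (fun i => c * f i) = c * rsum n f.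
Proof. rewrite !rsum_lsum. apply lsum_scal. Qed.

Lemma rsum_swap n p (f : nat -> nat -> R) :
  rsum n (fun i => rsum p (f i)) = rsum p (fun j => rsum n (fun i => f i j)).
Proof.
  rewrite (rsum_ext n _ (fun i => lsum (seq 0 p) (f i))) by (intros; apply rsum_lsum).
  rewrite (rsum_ext p _ (fun j => lsum (seq 0 n) (fun i => f i j)))
    by (intros; apply rsum_lsum).
  rewrite !rsum_lsum. apply lsum_swap.
Qed.

Lemma rsum_const n c : rsum n (fun _ => c) = INR n * c.
Proof.
  induction n as [|n IH]; [simpl; lra|]. rewrite S_INR. simpl rsum. rewrite IH. lra.
Qed.

Lemma rsum_term_le n f i :
  (forall j, (j < n)%nat -> 0 <= f j) -> (i < n)%nat -> f i <= rsum n f.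
Proof.
  induction n as [|n IH]; intros H Hi; [lia|]. simpl.
  destruct (Nat.eq_dec i n) as [->|Hne].
  - assert (0 <= rsum n f) by (apply rsum_nonneg; auto). lra.
  - assert (f i <= rsum n f) by (apply IH; auto; lia).
    pose proof (H n (Nat.lt_succ_diag_r n)). lra.
Qed.

Lemma rsum_lsum_swap {T} (l : list T) n (F : nat -> T -> R) :
  rsum n (fun i => lsum l (F i)) = lsum l (fun x => rsum n (fun i => F i x)).
Proof.
  rewrite rsum_lsum, lsum_swap. apply lsum_ext. intros. symmetry. apply rsum_lsum.
Qed.

Lemma INR_nsum n f : INR (nsum n f) = rsum n (fun i => INR (f i)).
Proof. induction n as [|n IH]; [reflexivity|]. simpl. rewrite plus_INR, IH. reflexivity. Qed.

(** * Classical indicator functions *)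

Definition indic (P : Prop) : R := if excluded_middle_informative P then 1 else 0.

Lemma indic_true (P : Prop) : P -> indic P = 1.
Proof. unfold indic. destruct excluded_middle_informative; tauto. Qed.

Lemma indic_false (P : Prop) : ~ P -> indic P = 0.
Proof. unfold indic. destruct excluded_middle_informative; tauto. Qed.

Lemma indic_bounds (P : Prop) : 0 <= indic P <= 1.
Proof. unfold indic. destruct excluded_middle_informative; lra. Qed.

Lemma indic_le (P Q : Prop) : (P -> Q) -> indic P <= indic Q.
Proof.
  intros H. destruct (classic P) as [HP|HP].
  - rewrite !indic_true by auto. lra.
  - rewrite (indic_false P) by auto. apply indic_bounds.
Qed.

Lemma indic_iff (P Q : Prop) : (P <-> Q) -> indic P = indic Q.
Proof. intros H. apply Rle_antisym; apply indic_le; tauto. Qed.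

(** * Words and prefixes *)

Definition agree (n : nat) (x y : nat -> nat) : Prop := forall k, (k < n)%nat -> x k = y k.

Definition upd (x : nat -> nat) (n a : nat) : nat -> nat :=
  fun k => if Nat.eqb k n then a else x k.

Lemma upd_eq x n a : upd x n a n = a.
Proof. unfold upd. rewrite Nat.eqb_refl. reflexivity. Qed.

Lemma upd_neq x n a k : k <> n -> upd x n a k = x k.
Proof. intros H. unfold upd. apply Nat.eqb_neq in H. rewrite H. reflexivity. Qed.

Lemma agree_upd x n a : agree n (upd x n a) x.
Proof. intros k Hk. apply upd_neq. lia. Qed.

Lemma agree_sym n x y : agree n x y -> agree n y x.
Proof. intros H k Hk. symmetry. auto. Qed.

Lemma agree_trans n x y z : agree n x y -> agree n y z -> agree n x z.
Proof. intros H1 H2 k Hk. rewrite H1 by auto. auto. Qed.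

Lemma agree_le n n' x y : (n' <= n)%nat -> agree n x y -> agree n' x y.
Proof. intros Hn H k Hk. apply H. lia. Qed.

Lemma agree_S n x y : agree (S n) x y <-> agree n x y /\ x n = y n.
Proof.
  split.
  - intros H. split; [apply (agree_le (S n)); auto | apply H; lia].
  - intros [H1 H2] k Hk. destruct (Nat.eq_dec k n) as [->|]; [auto|apply H1; lia].
Qed.

(** A word is a full sequence that is 0 from index n on, so that functions of sequences apply to
    words without coercion. *)
Fixpoint words (m n : nat) : list (nat -> nat) :=
  match n with
  | O => (fun _ => O) :: nil
  | S n' => flat_map (fun x => map (upd x n') (seq 0 m)) (words m n')
  end.

Lemma in_Sigma_upd m x n a : in_Sigma m x -> (a < m)%nat -> in_Sigma m (upd x n a).
Proof. intros Hx Ha k. unfold upd. destruct Nat.eqb; auto. Qed.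

Lemma words_Sigma m n x : (1 <= m)%nat -> In x (words m n) -> in_Sigma m x.
Proof.
  intros Hm. revert x. induction n as [|n IH]; simpl; intros x H.
  - destruct H as [<-|[]]. intros k. lia.
  - apply in_flat_map in H. destruct H as [y [Hy Hx]].
    apply in_map_iff in Hx. destruct Hx as [a [<- Ha]]. apply in_seq in Ha.
    apply in_Sigma_upd; [auto|lia].
Qed.

Lemma words_prefix m n y : in_Sigma m y -> exists x, In x (words m n) /\ agree n x y.
Proof.
  intros Hy. induction n as [|n [x [Hx Hag]]].
  - eexists. split; [left; reflexivity|]. intros k Hk. lia.
  - exists (upd x n (y n)). split.
    + simpl. apply in_flat_map. exists x. split; [auto|].
      apply in_map_iff. exists (y n). split; [auto|]. apply in_seq. specialize (Hy n). lia.
    + apply agree_S. split; [|apply upd_eq].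
      eapply agree_trans; [apply agree_upd|auto].
Qed.

(** Dependent choice on the tree of words: [Q n] sees only n letters, so one-letter extensions can
    be chained by [epsilon] and assembled into a limit. It serves both to prolong admissible words
    and to prove compactness of X_A. *)
Lemma infinite_branch m (Q : nat -> (nat -> nat) -> Prop) :
  (forall n x y, agree n x y -> Q n x -> Q n y) ->
  (forall n x, in_Sigma m x -> Q n x -> exists a, (a < m)%nat /\ Q (S n) (upd x n a)) ->
  forall n0 x0, in_Sigma m x0 -> Q n0 x0 ->
  exists y, in_Sigma m y /\ agree n0 y x0 /\ forall n, (n0 <= n)%nat -> Q n y.
Proof.
  intros Hdep Hstep n0 x0 Hx0 HQ0.
  pose (next := fun n x => epsilon (inhabits O) (fun a => (a < m)%nat /\ Q (S n) (upd x n a))).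
  pose (e := fix e (j : nat) : nat -> nat :=
     match j with O => x0 | S j' => upd (e j') (n0 + j') (next (n0 + j')%nat (e j')) end).
  assert (He : forall j, in_Sigma m (e j) /\ Q (n0 + j)%nat (e j)).
  { induction j as [|j [IH1 IH2]].
    - rewrite Nat.add_0_r. auto.
    - destruct (epsilon_spec (inhabits O) (fun a => (a < m)%nat /\ Q (S (n0 + j)) (upd (e j) (n0 + j) a))
                 (Hstep _ _ IH1 IH2)) as [H1 H2].
      split; [simpl; apply in_Sigma_upd; auto|]. rewrite Nat.add_succ_r. exact H2. }
  assert (Hst : forall i j k, (k < n0 + j)%nat -> e (j + i)%nat k = e j k).
  { induction i as [|i IH]; intros j k Hk; [rewrite Nat.add_0_r; reflexivity|].
    rewrite Nat.add_succ_r. simpl. rewrite upd_neq by lia. auto. }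
  (* Stage [S k] has already fixed letter k, since k < n0 + S k. *)
  pose (y := fun k => e (S k) k).
  assert (Hy : forall j, agree (n0 + j) (e j) y).
  { intros j k Hk. unfold y. destruct (Nat.le_gt_cases j (S k)) as [Hle|Hlt].
    - replace (S k) with (j + (S k - j))%nat by lia. rewrite Hst by lia. reflexivity.
    - replace j with (S k + (j - S k))%nat by lia. rewrite Hst by lia. reflexivity. }
  exists y. split; [|split].
  - intros k. apply (He (S k)).
  - apply agree_sym. intros k Hk. apply (Hy 0%nat). lia.
  - intros n Hn. replace n with (n0 + (n - n0))%nat by lia.
    apply (Hdep _ (e (n - n0)%nat)); [apply Hy|apply He].
Qed.

(** * Multiplicative chain kernels *)

Section Kernel.
Variables (m q : nat) (iota : nat -> R) (tau : nat -> nat -> R).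
Hypothesis hq : (2 <= q)%nat.

(* Weight of the letter [a] at 0-based position [k], i.e. paper index k+1. *)
Definition kern (x : nat -> nat) (k a : nat) : R :=
  if Nat.eqb (S k mod q) 0 then tau (x (S k / q - 1)%nat) a else iota a.

Fixpoint wt (n : nat) (x : nat -> nat) : R :=
  match n with O => 1 | S n' => wt n' x * kern x n' (x n') end.

(** An expectation when [iota] and each row of [tau] sum to 1; the number of admissible words of
    length n when [F = 1], [iota = 1] and [tau = A]. *)
Definition wsum (n : nat) (F : (nat -> nat) -> R) : R :=
  lsum (words m n) (fun x => wt n x * F x).

Lemma parent_lt k : (S k mod q = 0)%nat -> (S k / q - 1 < k)%nat /\ (1 <= S k / q)%nat
   /\ (S k = q * (S k / q))%nat.
Proof.
  intros H. pose proof (Nat.div_mod_eq (S k) q) as D. rewrite H in D.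
  assert (1 <= S k / q)%nat by nia. split; [nia|lia].
Qed.

Lemma kern_agree x y k a : agree k x y -> kern x k a = kern y k a.
Proof.
  intros H. unfold kern. destruct (Nat.eqb_spec (S k mod q) 0) as [Hk|]; [|reflexivity].
  apply parent_lt in Hk. rewrite H by lia. reflexivity.
Qed.

Lemma wt_agree n x y : agree n x y -> wt n x = wt n y.
Proof.
  induction n as [|n IH]; intros H; [reflexivity|]. apply agree_S in H. destruct H as [H1 H2].
  simpl. rewrite IH by auto. rewrite H2. f_equal. apply kern_agree. auto.
Qed.

Lemma wsum_S n F : wsum (S n) F = wsum n (fun x => rsum m (fun a => kern x n a * F (upd x n a))).
Proof.
  unfold wsum. simpl. rewrite lsum_flat_map. apply lsum_ext. intros x _.
  rewrite lsum_map, rsum_lsum, <- lsum_scal. apply lsum_ext. intros a _.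
  rewrite upd_eq, (wt_agree n _ _ (agree_upd x n a)), (kern_agree _ _ _ a (agree_upd x n a)). ring.
Qed.

Hypothesis hm : (1 <= m)%nat.

Lemma wsum_ext n F G : (forall x, in_Sigma m x -> F x = G x) -> wsum n F = wsum n G.
Proof.
  intros H. apply lsum_ext. intros x Hx. rewrite H; [reflexivity|].
  eapply words_Sigma; eauto.
Qed.

Lemma wsum_plus n F G : wsum n (fun x => F x + G x) = wsum n F + wsum n G.
Proof. unfold wsum. rewrite <- lsum_plus. apply lsum_ext. intros. ring. Qed.

Lemma wsum_scal n c F : wsum n (fun x => c * F x) = c * wsum n F.
Proof. unfold wsum. rewrite <- lsum_scal. apply lsum_ext. intros. ring. Qed.

Lemma wsum_rsum n p F : wsum n (fun x => rsum p (fun i => F i x)) = rsum p (fun i => wsum n (F i)).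
Proof.
  unfold wsum. rewrite rsum_lsum_swap. apply lsum_ext. intros x _. rewrite rsum_scal. reflexivity.
Qed.

Hypothesis hiota : forall a, (a < m)%nat -> 0 <= iota a.
Hypothesis htau : forall i a, (i < m)%nat -> (a < m)%nat -> 0 <= tau i a.

Lemma kern_nonneg x k a : in_Sigma m x -> (a < m)%nat -> 0 <= kern x k a.
Proof. intros Hx Ha. unfold kern. destruct Nat.eqb; auto. Qed.

Lemma wt_nonneg n x : in_Sigma m x -> 0 <= wt n x.
Proof.
  intros Hx. induction n as [|n IH]; simpl; [lra|].
  apply Rmult_le_pos; [auto|]. apply kern_nonneg; auto.
Qed.

(** Restricting to words of positive weight lets later comparisons assume admissibility. *)
Lemma wsum_le_pos n F G :
  (forall x, in_Sigma m x -> 0 < wt n x -> F x <= G x) -> wsum n F <= wsum n G.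
Proof.
  intros H. apply lsum_le. intros x Hx. apply words_Sigma in Hx; [|auto].
  destruct (wt_nonneg n x Hx) as [Hp|Hp].
  - apply Rmult_le_compat_l; [lra|auto].
  - rewrite <- Hp. lra.
Qed.

Lemma wsum_le n F G : (forall x, in_Sigma m x -> F x <= G x) -> wsum n F <= wsum n G.
Proof. intros H. apply wsum_le_pos. auto. Qed.

(** By induction with [wsum_S]: in the sum over the last letter only [w n] survives, so
    multiplicities in the list [words] are never discussed. *)
Lemma wsum_cylinder n w : in_Sigma m w -> wsum n (fun x => indic (agree n x w)) <= wt n w.
Proof.
  intros Hw. induction n as [|n IH].
  - unfold wsum. simpl. pose proof (indic_bounds (agree 0 (fun _ => O) w)). lra.
  - rewrite wsum_S. simpl wt.
    apply Rle_trans with (wsum n (fun x => kern w n (w n) * indic (agree n x w))).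
    2:{ rewrite wsum_scal, Rmult_comm. apply Rmult_le_compat_r; [apply kern_nonneg; auto|auto]. }
    apply wsum_le. intros x Hx.
    assert (Hz : forall a, kern x n a * indic (agree (S n) (upd x n a) w) =
       kern x n a * indic (agree n x w) * indic (a = w n)).
    { intros a. destruct (classic (agree (S n) (upd x n a) w)) as [H|H].
      - rewrite indic_true by auto. apply agree_S in H. rewrite upd_eq in H. destruct H as [H1 H2].
        rewrite (indic_true (a = w n)) by auto. rewrite indic_true; [ring|].
        eapply agree_trans; [apply agree_sym, agree_upd|eauto].
      - rewrite (indic_false _ H).
        destruct (classic (a = w n)) as [Ha|Ha]; [|rewrite (indic_false _ Ha); ring].
        rewrite (indic_false (agree n x w)); [ring|]. intros H'. apply H. apply agree_S.
        rewrite upd_eq. split; [|auto]. eapply agree_trans; [apply agree_upd|auto]. }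
    rewrite (rsum_ext m _ _ (fun a _ => Hz a)).
    assert (Hs : forall p, rsum p (fun a => kern x n a * indic (agree n x w) * indic (a = w n)) =
      kern x n (w n) * indic (agree n x w) * indic (w n < p)%nat).
    { induction p as [|p IHp]; simpl.
      - rewrite (indic_false (w n < 0)%nat) by lia. ring.
      - rewrite IHp. destruct (Nat.eq_dec p (w n)) as [->|Hne].
        + rewrite (indic_false (w n < w n)%nat), (indic_true (w n = w n)), (indic_true (w n < S (w n))%nat)
            by lia. ring.
        + rewrite (indic_false (p = w n)) by auto. rewrite (indic_iff (w n < S p)%nat (w n < p)%nat) by lia.
          ring. }
    rewrite Hs, (indic_true (w n < m)%nat) by apply Hw.
    destruct (classic (agree n x w)) as [H|H].
    + rewrite indic_true, (kern_agree x w) by auto. lra.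
    + rewrite indic_false by auto. lra.
Qed.

Hypothesis iota1 : rsum m iota = 1.
Hypothesis tau1 : forall i, (i < m)%nat -> rsum m (tau i) = 1.

Lemma kern_sum x k : in_Sigma m x -> rsum m (kern x k) = 1.
Proof. intros Hx. unfold kern. destruct Nat.eqb; auto. Qed.

Lemma wsum_one n : wsum n (fun _ => 1) = 1.
Proof.
  induction n as [|n IH]; [unfold wsum; simpl; ring|].
  rewrite wsum_S. etransitivity; [|exact IH]. apply wsum_ext. intros x Hx.
  rewrite <- (kern_sum x n Hx) at 1. apply rsum_ext. intros. ring.
Qed.

(** Consistency of the finite distributions: each further letter sums to 1. Events at different
    lengths can thus be compared at one common length. *)
Lemma wsum_prefix n k F :
  (forall x y, agree n x y -> F x = F y) -> (n <= k)%nat -> wsum k F = wsum n F.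
Proof.
  intros HF Hk. induction Hk as [|k Hk IH]; [reflexivity|].
  rewrite wsum_S, <- IH. apply wsum_ext. intros x Hx.
  rewrite (rsum_ext m _ (fun a => F x * kern x k a)).
  - rewrite rsum_scal, kern_sum by auto. ring.
  - intros a _. rewrite (HF (upd x k a) x); [ring|].
    apply (agree_le k); [auto|apply agree_upd].
Qed.

End Kernel.

(** * Exponential concentration of letter sums *)

Lemma div_S_dvd q n : (2 <= q)%nat -> (S n mod q = 0)%nat -> (S n / q = S (n / q))%nat.
Proof.
  intros Hq H. pose proof (Nat.div_mod_eq n q). pose proof (Nat.mod_upper_bound n q ltac:(lia)).
  destruct (Nat.eq_dec (S (n mod q)) q) as [He|He].
  - symmetry. apply (Nat.div_unique _ _ _ 0%nat); [lia|]. nia.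
  - rewrite <- (Nat.mod_unique (S n) q (n / q) (S (n mod q))) in H by lia. lia.
Qed.

Lemma div_S_ndvd q n : (2 <= q)%nat -> (S n mod q <> 0)%nat -> (S n / q = n / q)%nat.
Proof.
  intros Hq H. pose proof (Nat.div_mod_eq n q). pose proof (Nat.mod_upper_bound n q ltac:(lia)).
  destruct (Nat.eq_dec (S (n mod q)) q) as [He|He].
  - rewrite <- (Nat.mod_unique (S n) q (S (n / q)) 0%nat) in H; [lia|lia|nia].
  - symmetry. apply (Nat.div_unique _ _ _ (S (n mod q))); lia.
Qed.

Lemma div_le_self q n : (2 <= q)%nat -> (n / q <= n)%nat.
Proof. intros. apply Nat.Div0.div_le_upper_bound. nia. Qed.

Lemma INR_div_bounds q n : (2 <= q)%nat ->
  INR n / INR q - 1 <= INR (n / q) <= INR n / INR q.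
Proof.
  intros Hq. pose proof (Nat.div_mod_eq n q) as D.
  pose proof (Nat.mod_upper_bound n q ltac:(lia)) as U.
  apply (f_equal INR) in D. rewrite plus_INR, mult_INR in D.
  apply lt_INR in U. pose proof (pos_INR (n mod q)).
  assert (0 < INR q) by (apply lt_0_INR; lia).
  rewrite D. split.
  - apply Rmult_le_reg_r with (INR q); [auto|]. field_simplify; [|lra]. lra.
  - apply Rmult_le_reg_r with (INR q); [auto|]. field_simplify; [|lra]. lra.
Qed.

Lemma Rabs_le_inv a b : Rabs a <= b -> - b <= a <= b.
Proof. unfold Rabs. destruct Rcase_abs; lra. Qed.

(** From 1 - u <= exp (-u) follows exp u <= 1 / (1 - u), and (1 + u + 2 u^2)(1 - u) = 1 + u^2 (1 -
    2u) >= 1 for u <= 1/2. *)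
Lemma exp_le_quadratic u : Rabs u <= / 2 -> exp u <= 1 + u + 2 * u ^ 2.
Proof.
  intros H. apply Rabs_le_inv in H.
  pose proof (exp_ineq1_le (- u)) as H1. rewrite exp_Ropp in H1.
  pose proof (exp_pos u) as H2.
  assert (H3 : exp u * (1 - u) <= 1).
  { apply Rmult_le_reg_l with (/ exp u); [apply Rinv_0_lt_compat; auto|].
    rewrite <- Rmult_assoc, Rinv_l by lra. lra. }
  assert (H4 : 1 <= (1 + u + 2 * u ^ 2) * (1 - u)) by nra.
  apply Rmult_le_reg_r with (1 - u); lra.
Qed.

Lemma pow_le_exp u n : 0 <= u -> (1 + u) ^ n <= exp (u * INR n).
Proof.
  intros Hu. induction n as [|n IH]; [simpl; rewrite Rmult_0_r, exp_0; lra|].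
  rewrite S_INR, Rmult_plus_distr_l, exp_plus, Rmult_1_r. simpl.
  rewrite Rmult_comm. apply Rmult_le_compat; auto.
  - apply pow_le. lra.
  - lra.
  - apply exp_ineq1_le.
Qed.

Lemma exp_mono a b : a <= b -> exp a <= exp b.
Proof. intros [H|H]; [left; apply exp_increasing; auto|right; rewrite H; auto]. Qed.

Lemma exists_INR_ge r : exists n : nat, r <= INR n.
Proof.
  destruct (INR_unbounded r) as [n Hn]. exists n. lra.
Qed.

Lemma rsum_weighted_bound m (p f : nat -> R) B :
  (forall a, (a < m)%nat -> 0 <= p a) -> rsum m p = 1 ->
  (forall a, (a < m)%nat -> Rabs (f a) <= B) -> Rabs (rsum m (fun a => p a * f a)) <= B.
Proof.
  intros Hp H1 Hf. apply Rabs_le.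
  assert (forall a, (a < m)%nat -> - B <= f a <= B) by (intros; apply Rabs_le_inv; auto).
  assert (H2 : rsum m (fun a => - B * p a) = - B) by (rewrite rsum_scal, H1; ring).
  assert (H3 : rsum m (fun a => B * p a) = B) by (rewrite rsum_scal, H1; ring).
  split; [rewrite <- H2|rewrite <- H3]; apply rsum_le;
    intros a Ha; specialize (Hp a Ha); specialize (H a Ha); nra.
Qed.

Definition Ssum (f : nat -> R) (n : nat) (x : nat -> nat) : R := rsum n (fun k => f (x k)).

Lemma Ssum_agree f n x y : agree n x y -> Ssum f n x = Ssum f n y.
Proof. intros H. apply rsum_ext. intros i Hi. rewrite H by auto. reflexivity. Qed.

Lemma Ssum_bound m f B n x :
  (forall a, (a < m)%nat -> Rabs (f a) <= B) -> in_Sigma m x -> Rabs (Ssum f n x) <= INR n * B.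
Proof.
  intros Hf Hx. induction n as [|n IH].
  - unfold Ssum. simpl. rewrite Rabs_R0. lra.
  - unfold Ssum in *. simpl rsum. rewrite S_INR.
    eapply Rle_trans; [apply Rabs_triang|]. specialize (Hf (x n) (Hx n)). lra.
Qed.

Section Concentration.
Variables (m q : nat) (iota : nat -> R) (tau : nat -> nat -> R).
Hypothesis hm : (1 <= m)%nat.
Hypothesis hq : (2 <= q)%nat.
Hypothesis hiota : forall a, (a < m)%nat -> 0 <= iota a.
Hypothesis htau : forall i a, (i < m)%nat -> (a < m)%nat -> 0 <= tau i a.
Hypothesis iota1 : rsum m iota = 1.
Hypothesis tau1 : forall i, (i < m)%nat -> rsum m (tau i) = 1.

Local Notation Ex := (wsum m q iota tau).
Local Notation kn := (kern q iota tau).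

Definition Tf (f : nat -> R) (i : nat) : R := rsum m (fun a => tau i a * f a).
Definition mean0 (f : nat -> R) : R := rsum m (fun a => iota a * f a).

(* The compensator of [Ssum f n] is itself a letter sum, at the coarser scale n/q. *)
Definition Mart (f : nat -> R) (n : nat) (x : nat -> nat) : R :=
  Ssum f n x - mean0 f * INR (n - n / q) - Ssum (Tf f) (n / q) x.

Definition cmean (f : nat -> R) (x : nat -> nat) (n : nat) : R :=
  rsum m (fun a => kn x n a * f a).

(** If q divides n + 1, the new letter has a parent and its conditional mean is the new term of
    [Ssum (Tf f)]; otherwise it starts a chain and its mean is [mean0 f], counted by [n - n / q]. *)
Lemma Mart_S f n x : Mart f (S n) x = Mart f n x + (f (x n) - cmean f x n).
Proof.
  unfold Mart, cmean, kern.
  pose proof (div_le_self q n hq).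
  destruct (Nat.eqb_spec (S n mod q) 0) as [H0|H0].
  - rewrite div_S_dvd by auto.
    replace (S n - S (n / q))%nat with (n - n / q)%nat by lia.
    unfold Ssum. simpl rsum. rewrite Nat.sub_0_r. unfold Tf at 2. ring.
  - rewrite div_S_ndvd by auto.
    replace (S n - n / q)%nat with (S (n - n / q))%nat by lia.
    rewrite S_INR. unfold Ssum. simpl rsum. unfold mean0. ring.
Qed.

Lemma Mart_agree f n x y : agree n x y -> Mart f n x = Mart f n y.
Proof.
  intros H. unfold Mart. rewrite (Ssum_agree _ _ _ _ H).
  rewrite (Ssum_agree _ (n / q) x y); [reflexivity|].
  apply (agree_le n); [apply div_le_self; auto|auto].
Qed.

(** Azuma-type bound: increments are at most 2B, so the quadratic term is at most 2 (2 lam B)^2 = 8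
    lam^2 B^2, and each step multiplies the moment by at most 1 + v. *)
Lemma Mart_mgf f B lam n :
  (forall a, (a < m)%nat -> Rabs (f a) <= B) -> Rabs lam * (2 * B) <= / 2 ->
  Ex n (fun x => exp (lam * Mart f n x)) <= exp (8 * lam ^ 2 * B ^ 2 * INR n).
Proof.
  intros Hf Hlam.
  assert (HB : 0 <= B).
  { specialize (Hf 0%nat ltac:(lia)). pose proof (Rabs_pos (f 0%nat)). lra. }
  set (v := 8 * lam ^ 2 * B ^ 2).
  assert (Hv : 0 <= v) by (unfold v; nra).
  apply Rle_trans with ((1 + v) ^ n); [|apply pow_le_exp; auto].
  induction n as [|n IH].
  - unfold wsum. simpl. unfold Mart, Ssum. simpl. rewrite Nat.Div0.div_0_l. simpl.
    rewrite Rmult_0_r, !Rminus_0_r, Rmult_0_r, exp_0. lra.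
  - rewrite wsum_S by auto. simpl pow.
    apply Rle_trans with (Ex n (fun x => (1 + v) * exp (lam * Mart f n x))).
    2:{ rewrite wsum_scal. apply Rmult_le_compat_l; lra. }
    apply wsum_le; auto. intros x Hx.
    set (mu := cmean f x n).
    assert (Hmu : Rabs mu <= B).
    { apply rsum_weighted_bound; auto.
      - intros a Ha. apply (kern_nonneg m); auto.
      - apply kern_sum; auto. }
    (* The linear terms are kept apart: summed over a they cancel, because [mu] is the conditional
       mean. *)
    apply Rle_trans with (rsum m (fun a => exp (lam * Mart f n x) * ((1 + v) * kn x n a
        + lam * (kn x n a * f a) + (- lam * mu) * kn x n a))).
    + apply rsum_le. intros a Ha. rewrite Mart_S, upd_eq.
      replace (cmean f (upd x n a) n) with mu.
      2:{ apply rsum_ext. intros b _.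
          rewrite (kern_agree q iota tau hq (upd x n a) x); [reflexivity|apply agree_upd]. }
      rewrite (Mart_agree f n _ x (agree_upd x n a)).
      pose proof (kern_nonneg m q iota tau hiota htau x n a Hx Ha) as Hk.
      rewrite Rmult_plus_distr_l, exp_plus.
      pose proof (exp_pos (lam * Mart f n x)) as HE.
      assert (Hd : Rabs (f a - mu) <= 2 * B).
      { unfold Rminus. eapply Rle_trans; [apply Rabs_triang|]. rewrite Rabs_Ropp.
        specialize (Hf a Ha). lra. }
      assert (Hu : Rabs (lam * (f a - mu)) <= / 2).
      { rewrite Rabs_mult. eapply Rle_trans; [|apply Hlam].
        apply Rmult_le_compat_l; [apply Rabs_pos|auto]. }
      pose proof (exp_le_quadratic _ Hu) as Hq.
      assert (Hsq : 2 * (lam * (f a - mu)) ^ 2 <= v).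
      { rewrite Rpow_mult_distr. unfold v. apply Rabs_le_inv in Hd.
        assert ((f a - mu) ^ 2 <= 4 * B ^ 2) by nra.
        assert (0 <= lam ^ 2) by nra. nra. }
      rewrite Rmult_comm, Rmult_assoc.
      apply Rmult_le_compat_l; [lra|].
      replace ((1 + v) * kn x n a + lam * (kn x n a * f a) + - lam * mu * kn x n a)
        with ((1 + lam * (f a - mu) + v) * kn x n a) by ring.
      apply Rmult_le_compat_r; lra.
    + rewrite rsum_scal, !rsum_plus, !rsum_scal, kern_sum by auto.
      change (rsum m (fun a => kn x n a * f a)) with mu.
      apply Req_le. ring.
Qed.

(** Exponentially small probability from some length on. This form survives unions and the rescaling
    n -> n/q, and makes the probabilities summable over n. *)
Definition rare (Q : nat -> (nat -> nat) -> Prop) : Prop :=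
  exists C c n1, 0 <= C /\ 0 < c /\
    forall n, (n1 <= n)%nat -> Ex n (fun x => indic (Q n x)) <= C * exp (- c * INR n).

Lemma rare_sub Q Q' :
  (exists n1, forall n x, (n1 <= n)%nat -> in_Sigma m x -> 0 < wt q iota tau n x ->
     Q' n x -> Q n x) ->
  rare Q -> rare Q'.
Proof.
  intros [n2 H] (C & c & n1 & HC & Hc & HQ). exists C, c, (max n1 n2). split; [auto|split; [auto|]].
  intros n Hn. eapply Rle_trans; [|apply HQ; lia].
  apply wsum_le_pos; auto. intros x Hx Hp. apply indic_le. apply H; auto. lia.
Qed.

Lemma rare_or Q Q' : rare Q -> rare Q' -> rare (fun n x => Q n x \/ Q' n x).
Proof.
  intros (C & c & n1 & HC & Hc & HQ) (C' & c' & n1' & HC' & Hc' & HQ').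
  exists (C + C'), (Rmin c c'), (max n1 n1').
  split; [lra|split; [apply Rmin_glb_lt; auto|]]. intros n Hn.
  apply Rle_trans with (Ex n (fun x => indic (Q n x) + indic (Q' n x))).
  - apply wsum_le; auto. intros x _. destruct (classic (Q n x)) as [H|H].
    + rewrite (indic_true (Q n x)) by auto. pose proof (indic_bounds (Q' n x)).
      pose proof (indic_bounds (Q n x \/ Q' n x)). lra.
    + rewrite (indic_false (Q n x)) by auto. rewrite (indic_iff _ (Q' n x)) by tauto. lra.
  - rewrite wsum_plus. specialize (HQ n ltac:(lia)). specialize (HQ' n ltac:(lia)).
    assert (forall d, Rmin c c' <= d -> exp (- d * INR n) <= exp (- Rmin c c' * INR n)) as Hexp.
    { intros d Hd. pose proof (pos_INR n).
      assert (Hle : - d * INR n <= - Rmin c c' * INR n) by nra.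
      destruct Hle as [Hlt|Heq]; [left; apply exp_increasing; auto|right; rewrite Heq; auto]. }
    pose proof (Hexp c (Rmin_l _ _)). pose proof (Hexp c' (Rmin_r _ _)). nra.
Qed.

(** The event depends on the first n/q letters only, so [wsum_prefix] applies. The factor [exp c]
    pays for the rounding in n/q. *)
Lemma rare_div Q :
  (forall n x y, agree n x y -> Q n x -> Q n y) -> rare Q -> rare (fun n x => Q (n / q)%nat x).
Proof.
  intros Hdep (C & c & n1 & HC & Hc & HQ).
  assert (0 < INR q) by (apply lt_0_INR; lia).
  exists (C * exp c), (c / INR q), (q * n1)%nat.
  split; [pose proof (exp_pos c); nra|split; [apply Rdiv_lt_0_compat; auto|]].
  intros n Hn.
  rewrite (wsum_prefix m q iota tau hq hm iota1 tau1 (n / q)%nat).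
  - eapply Rle_trans; [apply HQ; apply Nat.div_le_lower_bound; lia|].
    rewrite Rmult_assoc, <- exp_plus. apply Rmult_le_compat_l; [auto|]. apply exp_mono.
    pose proof (INR_div_bounds q n hq) as [H1 _].
    replace (c + - (c / INR q) * INR n) with (- c * (INR n / INR q - 1)) by (field; lra). nra.
  - intros x y Hxy. apply indic_iff. split; apply Hdep; [auto|apply agree_sym; auto].
  - apply div_le_self; auto.
Qed.

(** Chernoff bound on both tails: [lam] minimises 8 lam^2 B^2 - lam eta, with value - lam eta / 2.
    The bounds eta <= 1 <= B keep it in the range of [Mart_mgf]. *)
Lemma Mart_rare f B eta :
  (forall a, (a < m)%nat -> Rabs (f a) <= B) -> 1 <= B -> 0 < eta <= 1 ->
  rare (fun n x => eta * INR n < Rabs (Mart f n x)).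
Proof.
  intros Hf HB Heta. set (lam := eta / (16 * B ^ 2)).
  assert (Hlam : 0 < lam) by (apply Rdiv_lt_0_compat; nra).
  assert (Hl : lam * (16 * B ^ 2) = eta) by (unfold lam; field; nra).
  exists 2, (lam * eta / 2), 0%nat. split; [lra|split; [nra|]]. intros n _.
  apply Rle_trans with (Ex n (fun x => exp (- lam * eta * INR n) *
      (exp (lam * Mart f n x) + exp (- lam * Mart f n x)))).
  - apply wsum_le; auto. intros x _. set (M := Mart f n x).
    rewrite Rmult_plus_distr_l, <- !exp_plus.
    pose proof (exp_pos (- lam * eta * INR n + lam * M)).
    pose proof (exp_pos (- lam * eta * INR n + - lam * M)).
    destruct (classic (eta * INR n < Rabs M)) as [H'|H']; [|rewrite indic_false by auto; lra].
    rewrite indic_true by auto. unfold Rabs in H'. destruct (Rcase_abs M).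
    + assert (1 <= exp (- lam * eta * INR n + - lam * M)); [|lra].
      rewrite <- exp_0. apply exp_mono. nra.
    + assert (1 <= exp (- lam * eta * INR n + lam * M)); [|lra].
      rewrite <- exp_0. apply exp_mono. nra.
  - rewrite wsum_scal, wsum_plus.
    assert (Hs : lam * (2 * B) <= / 2).
    { apply Rmult_le_reg_r with (8 * B); [lra|].
      replace (lam * (2 * B) * (8 * B)) with eta by (rewrite <- Hl; ring). lra. }
    pose proof (Mart_mgf f B lam n Hf) as H1. pose proof (Mart_mgf f B (- lam) n Hf) as H2.
    rewrite Rabs_Ropp in H2. rewrite Rabs_pos_eq in H1, H2 by lra.
    specialize (H1 Hs). specialize (H2 Hs).
    assert (Hv : 8 * lam ^ 2 * B ^ 2 = lam * eta / 2) by (rewrite <- Hl; field).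
    replace (8 * (- lam) ^ 2 * B ^ 2) with (lam * eta / 2) in H2 by (rewrite <- Hv; ring).
    rewrite Hv in H1.
    apply Rle_trans with (exp (- lam * eta * INR n) * (2 * exp (lam * eta / 2 * INR n))).
    + apply Rmult_le_compat_l; [left; apply exp_pos|lra].
    + replace (- (lam * eta / 2) * INR n) with (- lam * eta * INR n + lam * eta / 2 * INR n) by field.
      rewrite exp_plus. apply Req_le. ring.
Qed.

(** The centre [L] is attached to the precision [eps]; no limit as eps tends to 0 is formed. *)
Definition concentrates (f : nat -> R) (eps L : R) : Prop :=
  rare (fun n x => eps * INR n < Rabs (Ssum f n x - INR n * L)).

(** [Ssum f n] is the martingale plus [mean0 f * (n - n / q)] plus [Ssum (Tf f) (n / q)]. The last
    sum has at most n/2 terms, so its error relative to n is halved; the martingale and the rounding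
    cost eps/8 each, and 1/2 + 1/8 + 1/8 = 3/4. *)
Lemma concentrates_improve B eps :
  1 <= B -> 0 < eps <= 1 ->
  (forall f, (forall a, (a < m)%nat -> Rabs (f a) <= B) -> exists L, concentrates f (B * eps) L) ->
  (forall f, (forall a, (a < m)%nat -> Rabs (f a) <= B) -> exists L, concentrates f (B * (3 / 4 * eps)) L).
Proof.
  intros HB He IH f Hf.
  assert (HTf : forall a, (a < m)%nat -> Rabs (Tf f a) <= B).
  { intros i Hi. apply rsum_weighted_bound; auto. }
  destruct (IH (Tf f) HTf) as [L HL].
  set (eta := eps / 8). set (c := mean0 f).
  exists (c * (1 - / INR q) + L / INR q).
  destruct (exists_INR_ge ((Rabs c + Rabs L) / eta)) as [n1 Hn1].
  assert (Heta : 0 < eta) by (unfold eta; lra).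
  apply (rare_sub (fun n x => eta * INR n < Rabs (Mart f n x) \/
     B * eps * INR (n / q) < Rabs (Ssum (Tf f) (n / q) x - INR (n / q) * L))).
  - exists n1. intros n x Hn Hx _ Hbig. apply NNPP. intros Hno.
    apply not_or_and in Hno. destruct Hno as [H1 H2]. apply Rnot_lt_le in H1, H2.
    apply (Rlt_not_le _ _ Hbig). clear Hbig.
    assert (HnR : Rabs c + Rabs L <= eta * INR n).
    { apply le_INR in Hn. apply Rmult_le_reg_r with (/ eta); [apply Rinv_0_lt_compat; auto|].
      replace (eta * INR n * / eta) with (INR n) by (field; lra).
      unfold Rdiv in Hn1. lra. }
    pose proof (div_le_self q n hq) as Hd.
    unfold Mart in H1. rewrite minus_INR in H1 by auto. fold c in H1.
    pose proof (INR_div_bounds q n hq) as Hb.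
    assert (Hq2 : 2 <= INR q) by (apply (le_INR 2) in hq; simpl in hq; lra).
    set (S1 := Ssum f n x) in *. set (S2 := Ssum (Tf f) (n / q) x) in *.
    set (k := INR (n / q)) in *. set (N := INR n) in *. set (Q := N / INR q) in *.
    assert (HQN : Q <= N / 2).
    { unfold Q, Rdiv. apply Rmult_le_compat_l; [apply pos_INR|].
      apply Rinv_le_contravar; lra. }
    replace (S1 - N * (c * (1 - / INR q) + L / INR q))
      with ((S1 - c * (N - k) - S2) + (S2 - k * L) + c * (Q - k) + L * (k - Q))
      by (unfold Q; field; lra).
    assert (Hc : Rabs (c * (Q - k)) <= Rabs c).
    { rewrite Rabs_mult, (Rabs_pos_eq (Q - k)) by lra. pose proof (Rabs_pos c). nra. }
    assert (HLk : Rabs (L * (k - Q)) <= Rabs L).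
    { rewrite Rabs_mult, Rabs_minus_sym, (Rabs_pos_eq (Q - k)) by lra. pose proof (Rabs_pos L). nra. }
    assert (HN : 0 <= N) by apply pos_INR.
    assert (Hk2 : B * eps * k <= B * eps * (N / 2)).
    { apply Rmult_le_compat_l; [nra|lra]. }
    assert (Heb : 2 * (eta * N) <= B * (/ 4 * eps) * N).
    { unfold eta. assert (0 <= eps * N) by nra. nra. }
    eapply Rle_trans; [apply Rabs_triang|].
    eapply Rle_trans; [apply Rplus_le_compat_r, Rabs_triang|].
    eapply Rle_trans; [apply Rplus_le_compat_r, Rplus_le_compat_r, Rabs_triang|].
    lra.
  - apply rare_or.
    + apply (Mart_rare f B); auto. unfold eta. lra.
    + apply (rare_div (fun n x => B * eps * INR n < Rabs (Ssum (Tf f) n x - INR n * L))); [|exact HL].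
      intros n x y Hxy. rewrite (Ssum_agree _ _ _ _ Hxy). auto.
Qed.

Lemma concentrates_exists f B eps :
  (forall a, (a < m)%nat -> Rabs (f a) <= B) -> 0 < eps -> exists L, concentrates f eps L.
Proof.
  intros Hf He.
  set (B' := Rmax B 1).
  assert (HB : 1 <= B') by apply Rmax_r.
  assert (Hf' : forall a, (a < m)%nat -> Rabs (f a) <= B').
  { intros a Ha. eapply Rle_trans; [apply Hf; auto|apply Rmax_l]. }
  clearbody B'. clear Hf B.
  assert (Hall : forall r f, (forall a, (a < m)%nat -> Rabs (f a) <= B') ->
     exists L, concentrates f (B' * (3 / 4) ^ r) L).
  { induction r as [|r IH]; intros g Hg.
    (* At precision [B'] the centre 0 works: |S_n| <= n B' makes the event empty. *)
    - exists 0. simpl. unfold concentrates, rare. exists 0, 1, 0%nat. split; [lra|split; [lra|]]. intros n _.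
      apply Rle_trans with (Ex n (fun _ => 0 * 1)).
      + apply wsum_le; auto. intros x Hx. rewrite indic_false; [lra|].
        apply Rle_not_lt. rewrite Rmult_0_r, Rminus_0_r, Rmult_1_r, Rmult_comm.
        apply (Ssum_bound m); auto.
      + rewrite wsum_scal. lra.
    - apply (concentrates_improve B' ((3 / 4) ^ r)); auto. split; [apply pow_lt; lra|].
      rewrite <- (pow1 r). apply pow_incr. lra. }
  destruct (pow_lt_1_zero (3 / 4) ltac:(rewrite Rabs_pos_eq; lra) (eps / B')
     ltac:(apply Rdiv_lt_0_compat; lra)) as [r HR].
  specialize (HR r (le_n r)). rewrite Rabs_pos_eq in HR by (apply pow_le; lra).
  destruct (Hall r f Hf') as [L HL]. exists L. revert HL. apply rare_sub.
  exists 0%nat. intros n x _ _ _ H. eapply Rle_lt_trans; [|exact H].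
  apply Rmult_le_compat_r; [apply pos_INR|].
  apply Rlt_le. apply Rmult_lt_reg_r with (/ B'); [apply Rinv_0_lt_compat; lra|].
  replace (B' * (3 / 4) ^ r * / B') with ((3 / 4) ^ r) by (field; lra). exact HR.
Qed.

End Concentration.

(** * The vector t *)

Lemma argmax_exists (n : nat) (f : nat -> R) :
  (1 <= n)%nat -> exists i0, (i0 < n)%nat /\ forall i, (i < n)%nat -> f i <= f i0.
Proof.
  intros Hn. induction Hn as [|n Hn [i0 [Hi0 IH]]].
  - exists 0%nat. split; [lia|]. intros i Hi. replace i with 0%nat by lia. lra.
  - destruct (Rle_dec (f n) (f i0)) as [Hle|Hgt].
    + exists i0. split; [lia|]. intros i Hi.
      destruct (Nat.eq_dec i n) as [->|]; [auto|apply IH; lia].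
    + exists n. split; [lia|]. intros i Hi.
      destruct (Nat.eq_dec i n) as [->|]; [lra|]. specialize (IH i ltac:(lia)). lra.
Qed.

Lemma pow_superadd a b N : (1 <= N)%nat -> 0 <= a -> 0 <= b -> a ^ N + b ^ N <= (a + b) ^ N.
Proof.
  intros HN Ha Hb. induction HN as [|N HN IH]; [simpl; lra|]. simpl.
  pose proof (pow_le a N Ha). pose proof (pow_le b N Hb). nra.
Qed.

Lemma rsum_pow_le n (y : nat -> R) N :
  (1 <= N)%nat -> (forall j, (j < n)%nat -> 0 <= y j) -> rsum n (fun j => y j ^ N) <= rsum n y ^ N.
Proof.
  intros HN. induction n as [|n IH]; intros Hy; simpl.
  - apply pow_le. lra.
  - eapply Rle_trans; [|apply pow_superadd; auto; apply rsum_nonneg; auto].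
    assert (rsum n (fun j => y j ^ N) <= rsum n y ^ N) by auto. lra.
Qed.

Lemma Un_cv_pow u l N : Un_cv u l -> Un_cv (fun n => u n ^ N) (l ^ N).
Proof.
  intros H. induction N as [|N IH]; simpl.
  - intros e He. exists 0%nat. intros. rewrite Rdist_eq. auto.
  - apply CV_mult; auto.
Qed.

Lemma Un_cv_const c : Un_cv (fun _ => c) c.
Proof. intros e He. exists 0%nat. intros. rewrite Rdist_eq. auto. Qed.

Lemma Un_cv_rsum p (u : nat -> nat -> R) l :
  (forall j, (j < p)%nat -> Un_cv (fun n => u n j) (l j)) ->
  Un_cv (fun n => rsum p (u n)) (rsum p l).
Proof.
  induction p as [|p IH]; intros H; simpl; [apply Un_cv_const|].
  apply CV_plus; auto.
Qed.

Lemma Un_cv_S u l : Un_cv u l -> Un_cv (fun n => u (S n)) l.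
Proof. intros H e He. destruct (H e He) as [N HN]. exists N. intros n Hn. apply HN. lia. Qed.

Lemma linear_over_exp_cv q c : (2 <= q)%nat -> Un_cv (fun n => (INR n + c) / INR q ^ n) 0.
Proof.
  intros hq e He. assert (Hq2 : 2 <= INR q) by (apply (le_INR 2); auto).
  assert (Hb : forall n, INR n * INR n <= 4 * 2 ^ n).
  { induction n as [|n IH]; [simpl; lra|].
    destruct (Nat.le_gt_cases n 2) as [H2|H2].
    - destruct n as [|[|[|n]]]; try lia; simpl; lra.
    - rewrite S_INR. simpl. assert (3 <= INR n) by (apply (le_INR 3) in H2; simpl in H2; lra). nra. }
  destruct (exists_INR_ge (4 * (1 + Rabs c) / e + 1)) as [N HN].
  exists N. intros n Hn. unfold Rdist. rewrite Rminus_0_r.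
  apply le_INR in Hn. pose proof (Rabs_pos c) as Hc.
  assert (Hpos : 0 < 4 * (1 + Rabs c) / e) by (apply Rdiv_lt_0_compat; lra).
  assert (Hn1 : 1 <= INR n) by lra.
  assert (0 < 2 ^ n) by (apply pow_lt; lra).
  assert (Hp : 2 ^ n <= INR q ^ n) by (apply pow_incr; lra).
  unfold Rdiv. rewrite Rabs_mult, (Rabs_pos_eq (/ _)).
  2:{ left. apply Rinv_0_lt_compat. lra. }
  apply Rmult_lt_reg_r with (INR q ^ n); [lra|].
  rewrite Rmult_assoc, Rinv_l, Rmult_1_r by lra.
  assert (Hn2 : 4 * (1 + Rabs c) < e * INR n).
  { replace (4 * (1 + Rabs c)) with (e * (4 * (1 + Rabs c) / e)) by (field; lra).
    apply Rmult_lt_compat_l; lra. }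
  specialize (Hb n).
  apply Rle_lt_trans with (INR n + Rabs c).
  { eapply Rle_trans; [apply Rabs_triang|]. rewrite (Rabs_pos_eq (INR n)); lra. }
  apply Rle_lt_trans with (INR n * (1 + Rabs c)); [nra|].
  apply Rlt_le_trans with (e * 2 ^ n); [|apply Rmult_le_compat_l; lra].
  assert (INR n * (4 * (1 + Rabs c)) < INR n * (e * INR n)) by (apply Rmult_lt_compat_l; lra).
  nra.
Qed.

Lemma ln_le_mono x y : 0 < x -> x <= y -> ln x <= ln y.
Proof. intros Hx [H|H]; [left; apply ln_increasing; auto|right; rewrite H; auto]. Qed.

Lemma ln_pow_nat x n : 0 < x -> ln (x ^ n) = INR n * ln x.
Proof.
  intros Hx. induction n as [|n IH]; [simpl; rewrite ln_1; ring|].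
  simpl pow. rewrite ln_mult, IH, S_INR; [ring|auto|apply pow_lt; auto].
Qed.

Lemma rsum_delta p i g :
  rsum p (fun j => INR (if Nat.eqb i j then 1 else 0) * g j) = if Nat.ltb i p then g i else 0.
Proof.
  induction p as [|p IH]; [reflexivity|]. simpl rsum. rewrite IH.
  destruct (Nat.eqb_spec i p) as [->|Hne].
  - rewrite Nat.ltb_irrefl. destruct (Nat.ltb_spec p (S p)); [simpl; ring|lia].
  - destruct (Nat.ltb_spec i p); destruct (Nat.ltb_spec i (S p)); try lia; simpl; ring.
Qed.

(** * The power mean inequality with a quadratic remainder *)

Lemma pow_tangent s mu N :
  0 <= s -> 0 <= mu -> mu ^ S N + INR (S N) * mu ^ N * (s - mu) <= s ^ S N.
Proof.
  intros Hs Hmu. induction N as [|N IH]; [simpl; lra|].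
  pose proof (pow_le mu N Hmu). pose proof (pos_INR (S N)) as HN.
  apply Rle_trans with (s * (mu ^ S N + INR (S N) * mu ^ N * (s - mu))).
  - rewrite (S_INR (S N)). simpl pow.
    assert (0 <= INR (S N) * mu ^ N * (s - mu) ^ 2).
    { apply Rmult_le_pos; [nra|apply pow2_ge_0]. }
    nra.
  - change (s ^ S (S N)) with (s * s ^ S N). apply Rmult_le_compat_l; auto.
Qed.

(** Multiplying the tangent inequality for the exponent N + 1 by s produces the quadratic remainder
    exactly. This remainder later decides the case of equality. *)
Lemma pow_tangent_quadratic s mu N :
  0 <= s -> 0 <= mu ->
  mu ^ S (S N) + INR (S (S N)) * mu ^ S N * (s - mu) + INR (S N) * mu ^ N * (s - mu) ^ 2 <= s ^ S (S N).
Proof.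
  intros Hs Hmu. pose proof (pow_tangent s mu N Hs Hmu) as H.
  apply Rle_trans with (s * (mu ^ S N + INR (S N) * mu ^ N * (s - mu))).
  - rewrite (S_INR (S N)). simpl pow. apply Req_le. ring.
  - change (s ^ S (S N)) with (s * s ^ S N). apply Rmult_le_compat_l; auto.
Qed.

(** The linear term drops out because [mu] is the weighted mean, which leaves Jensen's inequality
    plus a multiple of the variance. *)
Lemma power_mean n (w s : nat -> R) N :
  (forall i, (i < n)%nat -> 0 <= w i) -> (forall i, (i < n)%nat -> 0 <= s i) -> 0 < rsum n w ->
  let mu := rsum n (fun i => w i * s i) / rsum n w in
  rsum n w * mu ^ S (S N) + INR (S N) * mu ^ N * rsum n (fun i => w i * (s i - mu) ^ 2)
    <= rsum n (fun i => w i * s i ^ S (S N)).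
Proof.
  intros Hw Hs HW mu.
  assert (Hmu : 0 <= mu).
  { unfold mu, Rdiv. apply Rmult_le_pos; [|left; apply Rinv_0_lt_compat; auto].
    apply rsum_nonneg. intros i Hi. apply Rmult_le_pos; auto. }
  apply Rle_trans with (rsum n (fun i => mu ^ S (S N) * w i +
     (INR (S (S N)) * mu ^ S N * (w i * s i) + (- (INR (S (S N)) * mu ^ S N * mu)) * w i
     + INR (S N) * mu ^ N * (w i * (s i - mu) ^ 2)))).
  - rewrite !rsum_plus, !rsum_scal.
    assert (rsum n (fun i => w i * s i) = mu * rsum n w) as -> by (unfold mu; field; lra).
    apply Req_le. ring.
  - apply rsum_le. intros i Hi. pose proof (pow_tangent_quadratic (s i) mu N (Hs i Hi) Hmu).
    specialize (Hw i Hi). nra.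
Qed.

(** * Powers of a primitive 0-1 matrix and its vector t *)

Section Matrix.
Variables (m q : nat) (A : nat -> nat -> nat).
Hypothesis hm : (2 <= m)%nat.
Hypothesis h01 : zero_one m A.
Hypothesis hprim : primitive_mx m A.

Definition Aop (g : nat -> R) (i : nat) : R := rsum m (fun j => INR (A i j) * g j).

Lemma entry_01 i j : (i < m)%nat -> (j < m)%nat -> INR (A i j) = 0 \/ INR (A i j) = 1.
Proof. intros Hi Hj. destruct (h01 i j Hi Hj) as [->| ->]; auto. Qed.

Lemma Aop_le g h i :
  (i < m)%nat -> (forall j, (j < m)%nat -> g j <= h j) -> Aop g i <= Aop h i.
Proof.
  intros Hi H. apply rsum_le. intros j Hj. apply Rmult_le_compat_l; [apply pos_INR|auto].
Qed.

Lemma mpow_apply n g i :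
  (i < m)%nat -> rsum m (fun j => INR (mpow m A n i j) * g j) = Nat.iter n Aop g i.
Proof.
  intros Hi. revert g. induction n as [|n IH]; intros g.
  - simpl mpow. rewrite rsum_delta. apply Nat.ltb_lt in Hi. rewrite Hi. reflexivity.
  - rewrite Nat.iter_succ_r, <- IH. simpl mpow.
    rewrite (rsum_ext m _ (fun j => rsum m (fun l => INR (mpow m A n i l) * (INR (A l j) * g j)))).
    + rewrite rsum_swap. apply rsum_ext. intros l _. rewrite rsum_scal. reflexivity.
    + intros j _. rewrite INR_nsum, Rmult_comm, <- rsum_scal. apply rsum_ext.
      intros l _. rewrite mult_INR. ring.
Qed.

(** A zero row of A would stay zero in every power p >= 1, contrary to primitivity. *)
Lemma row_nonzero i : (i < m)%nat -> exists j, (j < m)%nat /\ A i j = 1%nat.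
Proof.
  intros Hi. apply NNPP. intros Hno. destruct hprim as [p Hp].
  assert (Hz : forall g, Aop g i = 0).
  { intros g. unfold Aop. rewrite (rsum_ext m _ (fun _ => 0)).
    - rewrite rsum_const. ring.
    - intros j Hj. destruct (h01 i j Hi Hj) as [->|H1]; [simpl; ring|].
      exfalso. eauto. }
  destruct p as [|p].
  (* The exponent 0 is excluded by an off-diagonal entry of the identity, as m >= 2. *)
  - specialize (Hp 0%nat 1%nat ltac:(lia) ltac:(lia)). simpl in Hp. lia.
  - pose proof (mpow_apply (S p) (fun _ => 1) i Hi) as H. simpl Nat.iter in H. rewrite Hz in H.
    assert (INR (mpow m A (S p) i 0) * 1 <= 0).
    { rewrite <- H.
      apply (rsum_term_le m (fun j => INR (mpow m A (S p) i j) * 1) 0%nat); [|lia].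
      intros j _. pose proof (pos_INR (mpow m A (S p) i j)). lra. }
    specialize (Hp i 0%nat Hi ltac:(lia)). apply lt_INR in Hp. simpl INR in Hp at 1. lra.
Qed.

Lemma Aop_ge_1 g i :
  (i < m)%nat -> (forall j, (j < m)%nat -> 1 <= g j) -> 1 <= Aop g i.
Proof.
  intros Hi Hg. destruct (row_nonzero i Hi) as [j [Hj HA]].
  apply Rle_trans with (INR (A i j) * g j).
  - rewrite HA. simpl. specialize (Hg j Hj). lra.
  - apply (rsum_term_le m (fun j => INR (A i j) * g j)); [|auto].
    intros k Hk. specialize (Hg k Hk). pose proof (pos_INR (A i k)). nra.
Qed.

Lemma Aop_le_mult g c i :
  (i < m)%nat -> (forall j, (j < m)%nat -> 0 <= g j <= c) -> Aop g i <= INR m * c.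
Proof.
  intros Hi Hg. rewrite <- rsum_const. apply rsum_le. intros j Hj.
  specialize (Hg j Hj). destruct (entry_01 i j Hi Hj) as [->| ->]; lra.
Qed.

Lemma INR_m_ge : 2 <= INR m.
Proof. apply (le_INR 2). auto. Qed.

(** Row sums of [A^r]: the number of ways to continue the letter i along its chain by r letters. *)
Definition vrow (r : nat) : nat -> R := Nat.iter r Aop (fun _ => 1).

Lemma vrow_S r i : vrow (S r) i = Aop (vrow r) i.
Proof. reflexivity. Qed.

Lemma vrow_bounds r i : (i < m)%nat -> 1 <= vrow r i <= INR m ^ r.
Proof.
  revert i. induction r as [|r IH]; intros i Hi; [unfold vrow; simpl; lra|].
  rewrite vrow_S. split.
  - apply Aop_ge_1; auto. intros; apply IH; auto.
  - simpl. apply Aop_le_mult; auto. intros j Hj. specialize (IH j Hj). lra.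
Qed.

Definition asum (r : nat) : R := INR (ones_form m A r).

Lemma asum_vrow r : asum r = rsum m (vrow r).
Proof.
  unfold asum, ones_form. rewrite INR_nsum. apply rsum_ext. intros i Hi.
  unfold vrow. rewrite <- mpow_apply, INR_nsum by auto. apply rsum_ext. intros. ring.
Qed.

Lemma asum_bounds r : 1 <= asum r <= INR m ^ S r.
Proof.
  rewrite asum_vrow. pose proof INR_m_ge. split.
  - eapply Rle_trans; [|apply (rsum_term_le m (vrow r) 0%nat); [|lia]].
    + apply vrow_bounds. lia.
    + intros j Hj. pose proof (vrow_bounds r j Hj). lra.
  - simpl. rewrite <- rsum_const. apply rsum_le. intros. apply vrow_bounds. auto.
Qed.

Lemma ln_m_pos : 0 < ln (INR m).
Proof. rewrite <- ln_1. apply ln_increasing; [lra|]. pose proof INR_m_ge. lra. Qed.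

Lemma ln_asum_bounds r : 0 <= ln (asum r) <= INR (S r) * ln (INR m).
Proof.
  pose proof (asum_bounds r). pose proof INR_m_ge. split.
  - rewrite <- ln_1. apply ln_le_mono; lra.
  - rewrite <- ln_pow_nat by lra. apply ln_le_mono; lra.
Qed.

Hypothesis hq : (2 <= q)%nat.

Lemma INR_q_ge : 2 <= INR q.
Proof. apply (le_INR 2). auto. Qed.

(** Fixed-point iteration t -> (A t)^(1/q) from the vector 1. It increases because A 1 >= 1, and
    stays below m because m * m <= m^q. *)
Fixpoint titer (n : nat) : nat -> R :=
  match n with
  | O => fun _ => 1
  | S n' => fun i => Rpower (Aop (titer n') i) (/ INR q)
  end.

Lemma root_pow x : 0 < x -> Rpower x (/ INR q) ^ q = x.
Proof.
  intros Hx. pose proof INR_q_ge. rewrite <- Rpower_pow by apply exp_pos.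
  rewrite Rpower_mult, Rinv_l by lra. apply Rpower_1; auto.
Qed.

Lemma pow_root x : 0 < x -> Rpower (x ^ q) (/ INR q) = x.
Proof.
  intros Hx. pose proof INR_q_ge. rewrite <- Rpower_pow by auto.
  rewrite Rpower_mult, Rinv_r by lra. apply Rpower_1; auto.
Qed.

Lemma root_le x y : 0 < x <= y -> Rpower x (/ INR q) <= Rpower y (/ INR q).
Proof.
  intros H. pose proof INR_q_ge. apply Rle_Rpower_l; [|auto].
  left. apply Rinv_0_lt_compat. lra.
Qed.

Lemma titer_bounds n i : (i < m)%nat -> 1 <= titer n i <= INR m.
Proof.
  pose proof INR_m_ge as Hm2. revert i. induction n as [|n IH]; intros i Hi; simpl; [lra|].
  assert (H1 : 1 <= Aop (titer n) i) by (apply Aop_ge_1; auto; intros; apply IH; auto).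
  split.
  - rewrite <- (pow_root 1) at 1 by lra. rewrite pow1. apply root_le. lra.
  - rewrite <- (pow_root (INR m)) by lra. apply root_le. split; [lra|].
    eapply Rle_trans; [apply (Aop_le_mult _ (INR m)); auto|].
    + intros j Hj. specialize (IH j Hj). lra.
    + replace (INR m * INR m) with (INR m ^ 2) by ring. apply Rle_pow; [lra|auto].
Qed.

Lemma titer_growing n i : (i < m)%nat -> titer n i <= titer (S n) i.
Proof.
  revert i. induction n as [|n IH]; intros i Hi.
  - apply titer_bounds. auto.
  - simpl. apply root_le. split.
    + assert (1 <= Aop (titer n) i); [|lra]. apply Aop_ge_1; auto. intros; apply titer_bounds; auto.
    + apply Aop_le; auto.
Qed.

(** Superadditivity of powers and entries in {0,1} give sum_j A(i,j) t_j^(q^k) <= (A t)_i^(q^k). The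
    purpose is to exclude t_i = 1. *)
Lemma iter_Aop_le_pow t k i :
  (forall i, (i < m)%nat -> 0 <= t i /\ t i ^ q = Aop t i) -> (i < m)%nat ->
  Nat.iter k Aop t i <= t i ^ (q ^ k).
Proof.
  intros Ht. revert i. induction k as [|k IH]; intros i Hi; [simpl; lra|]. simpl Nat.iter.
  apply Rle_trans with (rsum m (fun j => (INR (A i j) * t j) ^ (q ^ k))).
  - apply rsum_le. intros j Hj. specialize (IH j Hj).
    destruct (entry_01 i j Hi Hj) as [->| ->].
    + rewrite !Rmult_0_l. apply pow_le. lra.
    + rewrite !Rmult_1_l. auto.
  - eapply Rle_trans; [apply rsum_pow_le|].
    + pose proof (Nat.pow_nonzero q k). lia.
    + intros j Hj. apply Rmult_le_pos; [apply pos_INR|apply Ht; auto].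
    + change (rsum m (fun j => INR (A i j) * t j)) with (Aop t i).
      destruct (Ht i Hi) as [_ <-]. rewrite <- pow_mult, Nat.pow_succ_r'. lra.
Qed.

Lemma t_vec_exists : exists t, t_vec m q A t.
Proof.
  set (t := fun i => epsilon (inhabits 0) (fun l => Un_cv (fun n => titer n i) l)).
  assert (Hcv : forall i, (i < m)%nat -> Un_cv (fun n => titer n i) (t i)).
  { intros i Hi. unfold t. apply epsilon_spec.
    destruct (growing_cv (fun n => titer n i)) as [l Hl]; [| |exists l; auto].
    - intros n. apply titer_growing. auto.
    - exists (INR m). intros x [n ->]. apply titer_bounds. auto. }
  assert (Ht1 : forall i, (i < m)%nat -> 1 <= t i).
  { intros i Hi. apply Rnot_lt_le. intros Hlt.
    destruct (Hcv i Hi (1 - t i) ltac:(lra)) as [N HN]. specialize (HN N (le_n N)).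
    pose proof (titer_bounds N i Hi). unfold Rdist in HN. rewrite Rabs_pos_eq in HN; lra. }
  assert (Heq : forall i, (i < m)%nat -> t i ^ q = Aop t i).
  { intros i Hi. apply UL_sequence with (fun n => titer (S n) i ^ q).
    - apply Un_cv_pow. apply (Un_cv_S (fun n => titer n i)). auto.
    - assert (Hc : Un_cv (fun n => Aop (titer n) i) (Aop t i)).
      { apply (Un_cv_rsum m (fun n j => INR (A i j) * titer n j)).
        intros j Hj. apply CV_mult; [apply Un_cv_const|auto]. }
      intros e He. destruct (Hc e He) as [N HN]. exists N. intros n Hn.
      simpl titer. rewrite root_pow; [apply HN; auto|].
      assert (1 <= Aop (titer n) i); [|lra]. apply Aop_ge_1; auto. intros; apply titer_bounds; auto. }
  exists t. intros i Hi. split; [|apply Heq; auto].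
  (* If t_i = 1 then (A^p t)_i <= 1, whereas a strictly positive A^p and t >= 1 give (A^p t)_i >=
     m. *)
  destruct (Ht1 i Hi) as [Hlt|H1]; [auto|exfalso].
  destruct hprim as [p Hp].
  pose proof (iter_Aop_le_pow t p i) as Hle. rewrite <- H1, pow1 in Hle.
  assert (2 <= Nat.iter p Aop t i).
  { rewrite <- mpow_apply by auto. eapply Rle_trans; [apply INR_m_ge|].
    rewrite <- (Rmult_1_r (INR m)), <- rsum_const. apply rsum_le. intros j Hj.
    specialize (Hp i j Hi Hj). apply (le_INR 1) in Hp. simpl INR in Hp at 1.
    specialize (Ht1 j Hj). nra. }
  assert (Nat.iter p Aop t i <= 1); [|lra]. apply Hle; auto.
  intros j Hj. split; [specialize (Ht1 j Hj); lra|auto].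
Qed.

(** Let c be the largest ratio t'_i / t_i, attained at i0. If c > 1, then at i0 one has c^q t^q = A
    t' <= c A t = c t^q, impossible for q >= 2. *)
Lemma t_vec_le t t' : t_vec m q A t -> t_vec m q A t' -> forall i, (i < m)%nat -> t' i <= t i.
Proof.
  intros Ht Ht' i Hi.
  destruct (argmax_exists m (fun i => t' i / t i) ltac:(lia)) as [i0 [Hi0 Hmax]].
  simpl in Hmax. set (c := t' i0 / t i0) in *.
  assert (Hc : forall j, (j < m)%nat -> t' j <= c * t j).
  { intros j Hj. destruct (Ht j Hj) as [H1 _]. specialize (Hmax j Hj).
    apply Rmult_le_reg_r with (/ t j); [apply Rinv_0_lt_compat; lra|].
    replace (c * t j * / t j) with c by (field; lra). exact Hmax. }
  destruct (Rle_dec c 1) as [Hc1|Hc1].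
  { specialize (Hc i Hi). destruct (Ht i Hi). nra. }
  exfalso. apply Rnot_le_lt in Hc1.
  destruct (Ht i0 Hi0) as [Ht1 Hteq]. destruct (Ht' i0 Hi0) as [Ht1' Hteq'].
  assert (Heq : t' i0 = c * t i0) by (unfold c; field; lra).
  assert (Hle : t' i0 ^ q <= c * t i0 ^ q).
  { rewrite Hteq, Hteq', <- rsum_scal. apply rsum_le. intros j Hj.
    specialize (Hc j Hj). destruct (entry_01 i0 j Hi0 Hj) as [->| ->]; lra. }
  rewrite Heq, Rpow_mult_distr in Hle.
  assert (0 < t i0 ^ q) by (apply pow_lt; lra).
  apply Rmult_le_reg_r in Hle; [|auto].
  assert (c ^ 2 <= c ^ q) by (apply Rle_pow; [lra|auto]). nra.
Qed.

Lemma t_vec_unique t t' :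
  t_vec m q A t -> t_vec m q A t' -> forall i, (i < m)%nat -> t' i = t i.
Proof. intros Ht Ht' i Hi. apply Rle_antisym; apply t_vec_le; auto. Qed.

Lemma series_cv : exists S, infinite_sum (fun n => ln (asum n) / INR q ^ (n + 2)) S.
Proof.
  pose proof ln_m_pos as Hl. pose proof INR_q_ge as Hq2.
  assert (Hterm : forall n, 0 <= ln (asum n) / INR q ^ (n + 2) <= INR (S n) / 2 ^ (n + 2) * ln (INR m)).
  { intros n. pose proof (ln_asum_bounds n) as [H0 H1].
    assert (0 < 2 ^ (n + 2)) by (apply pow_lt; lra).
    assert (2 ^ (n + 2) <= INR q ^ (n + 2)) by (apply pow_incr; lra).
    assert (Hi : 0 < / INR q ^ (n + 2)) by (apply Rinv_0_lt_compat; lra).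
    assert (/ INR q ^ (n + 2) <= / 2 ^ (n + 2)) by (apply Rinv_le_contravar; lra).
    unfold Rdiv. split; [nra|].
    apply Rle_trans with (INR (S n) * ln (INR m) * / INR q ^ (n + 2)); [nra|].
    assert (0 <= INR (S n) * ln (INR m)) by lra. nra. }
  destruct (growing_cv (sum_f_R0 (fun n => ln (asum n) / INR q ^ (n + 2)))) as [S HS].
  - intros n. simpl. specialize (Hterm (S n)). simpl in Hterm. lra.
  - exists (ln (INR m)). intros x [n ->].
    (* Closed form of the partial sums of (k + 1) / 2^(k + 2), which dominate those for every q >=
       2. *)
    apply Rle_trans with ((1 - (INR n + 3) / 2 ^ (n + 2)) * ln (INR m)).
    + induction n as [|n IH].
      * simpl sum_f_R0. specialize (Hterm 0%nat). simpl in Hterm. simpl. lra.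
      * rewrite tech5. specialize (Hterm (S n)).
        replace ((1 - (INR (S n) + 3) / 2 ^ (S n + 2)) * ln (INR m)) with
          ((1 - (INR n + 3) / 2 ^ (n + 2)) * ln (INR m) + INR (S (S n)) / 2 ^ (S n + 2) * ln (INR m)).
        { lra. }
        rewrite !S_INR. simpl. field. apply pow_nonzero. lra.
    + assert (0 <= (INR n + 3) / 2 ^ (n + 2)).
      { pose proof (pos_INR n). assert (0 < 2 ^ (n + 2)) by (apply pow_lt; lra).
        apply Rlt_le, Rdiv_lt_0_compat; lra. }
      nra.
  - exists S. exact HS.
Qed.

(** * Comparison of the two dimension formulas *)

(** The row vector 1^T A^k. Multiplying on the right makes A act on t in [Wdot_S], where it turns
    into the power q. *)
Fixpoint wcol (k : nat) : nat -> R :=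
  match k with
  | O => fun _ => 1
  | S k' => fun j => rsum m (fun l => wcol k' l * INR (A l j))
  end.

Lemma wcol_mpow k j : (j < m)%nat -> wcol k j = rsum m (fun i => INR (mpow m A k i j)).
Proof.
  revert j. induction k as [|k IH]; intros j Hj.
  - simpl. rewrite (rsum_ext m _ (fun i => INR (if Nat.eqb j i then 1 else 0) * 1)).
    + rewrite (rsum_delta m j (fun _ => 1)). apply Nat.ltb_lt in Hj. rewrite Hj. reflexivity.
    + intros i _. rewrite Nat.eqb_sym. ring.
  - simpl. rewrite (rsum_ext m _ (fun l => rsum m (fun i => INR (mpow m A k i l) * INR (A l j)))).
    + rewrite rsum_swap. apply rsum_ext. intros i _. rewrite INR_nsum. apply rsum_ext.
      intros l _. rewrite mult_INR. reflexivity.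
    + intros l Hl. rewrite IH, Rmult_comm, <- rsum_scal by auto. apply rsum_ext. intros. ring.
Qed.

Lemma wcol_nonneg k j : (j < m)%nat -> 0 <= wcol k j.
Proof. intros Hj. rewrite wcol_mpow by auto. apply rsum_nonneg. intros. apply pos_INR. Qed.

Lemma wcol_sum k : rsum m (wcol k) = asum k.
Proof.
  unfold asum, ones_form. rewrite INR_nsum.
  rewrite (rsum_ext m (wcol k) (fun j => rsum m (fun i => INR (mpow m A k i j)))).
  - rewrite rsum_swap. apply rsum_ext. intros i _. rewrite INR_nsum. reflexivity.
  - intros j Hj. apply wcol_mpow. auto.
Qed.

Section Compare.
Variable t : nat -> R.
Hypothesis ht : t_vec m q A t.

Lemma t_le_m i : (i < m)%nat -> t i <= INR m.
Proof.
  intros Hi. destruct (argmax_exists m t ltac:(lia)) as [i0 [Hi0 Hmax]].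
  apply Rle_trans with (t i0); [auto|].
  destruct (ht i0 Hi0) as [H1 Heq].
  assert (Hle : t i0 ^ q <= INR m * t i0).
  { rewrite Heq. apply (Aop_le_mult t (t i0)); auto. intros j Hj.
    destruct (ht j Hj). specialize (Hmax j Hj). lra. }
  assert (t i0 ^ 2 <= t i0 ^ q) by (apply Rle_pow; [lra|auto]). nra.
Qed.

Definition Wdot (k : nat) : R := rsum m (fun j => wcol k j * t j).

Lemma Wdot_S k : Wdot (S k) = rsum m (fun l => wcol k l * t l ^ q).
Proof.
  unfold Wdot. simpl.
  rewrite (rsum_ext m _ (fun j => rsum m (fun l => wcol k l * (INR (A l j) * t j)))).
  - rewrite rsum_swap. apply rsum_ext. intros l Hl. rewrite rsum_scal.
    destruct (ht l Hl) as [_ ->]. reflexivity.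
  - intros j _. rewrite Rmult_comm, <- rsum_scal. apply rsum_ext. intros. ring.
Qed.

Lemma Wdot_bounds k : 1 <= Wdot k <= INR m ^ S (S k).
Proof.
  pose proof (asum_bounds k) as Ha. split.
  - eapply Rle_trans; [apply Ha|]. rewrite <- wcol_sum. apply rsum_le.
    intros j Hj. pose proof (wcol_nonneg k j Hj). destruct (ht j Hj). nra.
  - change (INR m ^ S (S k)) with (INR m * INR m ^ S k).
    apply Rle_trans with (INR m * asum k).
    + rewrite <- wcol_sum, <- rsum_scal. apply rsum_le. intros j Hj.
      pose proof (wcol_nonneg k j Hj). pose proof (t_le_m j Hj). nra.
    + apply Rmult_le_compat_l; [apply pos_INR|apply Ha].
Qed.

(** The logarithmic defect of the power mean inequality at level k. With weights q^-(k+1) the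
    defects add up to a positive multiple of dim_M - dim_H. *)
Definition gap (k : nat) : R :=
  (INR q - 1) * ln (asum k) + ln (Wdot (S k)) - INR q * ln (Wdot k).

Lemma asum_Wdot k : asum k * (Wdot k / asum k) ^ q <= Wdot (S k).
Proof.
  pose proof (asum_bounds k). destruct q as [|[|N]] eqn:Eq; try lia. rewrite <- Eq in *.
  rewrite Wdot_S, Eq, <- wcol_sum.
  pose proof (power_mean m (wcol k) t N (wcol_nonneg k)) as P. cbv zeta in P.
  eapply Rle_trans; [|apply P].
  - change (rsum m (fun i => wcol k i * t i)) with (Wdot k).
    match goal with |- ?a <= ?a + ?b => assert (0 <= b); [|lra] end.
    apply Rmult_le_pos; [apply Rmult_le_pos; [apply pos_INR|]|].
    + apply pow_le. rewrite wcol_sum. pose proof (Wdot_bounds k).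
      apply Rlt_le, Rdiv_lt_0_compat; lra.
    + apply rsum_nonneg. intros i Hi. apply Rmult_le_pos; [apply wcol_nonneg; auto|apply pow2_ge_0].
  - intros i Hi. destruct (ht i Hi). lra.
  - rewrite wcol_sum. lra.
Qed.

Lemma gap_log k : gap k = ln (Wdot (S k)) - ln (asum k * (Wdot k / asum k) ^ q).
Proof.
  pose proof (asum_bounds k). pose proof (Wdot_bounds k).
  assert (0 < Wdot k / asum k) by (apply Rdiv_lt_0_compat; lra).
  rewrite ln_mult, ln_pow_nat; [|auto|lra|apply pow_lt; auto].
  unfold Rdiv. rewrite ln_mult, ln_Rinv; [|lra|lra|apply Rinv_0_lt_compat; lra].
  unfold gap. ring.
Qed.

Lemma gap_nonneg k : 0 <= gap k.
Proof.
  rewrite gap_log. pose proof (asum_bounds k). pose proof (Wdot_bounds k).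
  assert (ln (asum k * (Wdot k / asum k) ^ q) <= ln (Wdot (S k))); [|lra].
  apply ln_le_mono; [|apply asum_Wdot].
  apply Rmult_lt_0_compat; [lra|]. apply pow_lt, Rdiv_lt_0_compat; lra.
Qed.

(** At k = 0 the weights [wcol 0] are all 1, so the vanishing of the variance term in [power_mean]
    fixes every t_i at the mean. *)
Lemma gap_0_eq : gap 0 = 0 -> forall i j, (i < m)%nat -> (j < m)%nat -> t i = t j.
Proof.
  intros Hg.
  pose proof (asum_bounds 0) as Ha. pose proof (Wdot_bounds 0) as Hw.
  assert (Hmu : 0 < Wdot 0 / asum 0) by (apply Rdiv_lt_0_compat; lra).
  assert (Heq : asum 0 * (Wdot 0 / asum 0) ^ q = Wdot 1).
  { rewrite gap_log in Hg. apply ln_inv.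
    - apply Rmult_lt_0_compat; [lra|apply pow_lt; auto].
    - pose proof (Wdot_bounds 1). lra.
    - lra. }
  cut (forall i, (i < m)%nat -> t i = Wdot 0 / asum 0).
  { intros H i j Hi Hj. rewrite (H i Hi), (H j Hj). reflexivity. }
  intros i Hi.
  destruct q as [|[|N]] eqn:Eq; try lia. rewrite <- Eq in *.
  pose proof (power_mean m (wcol 0) t N (wcol_nonneg 0)) as P. cbv zeta in P.
  change (rsum m (fun i => wcol 0 i * t i)) with (Wdot 0) in P.
  rewrite wcol_sum in P. rewrite Wdot_S, Eq in Heq. rewrite <- Heq in P.
  set (mu := Wdot 0 / asum 0) in *.
  assert (P' := P ltac:(intros j Hj; destruct (ht j Hj); lra) ltac:(lra)). clear P.
  assert (Hsum : rsum m (fun i => wcol 0 i * (t i - mu) ^ 2) <= 0).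
  { apply Rmult_le_reg_l with (INR (S N) * mu ^ N).
    - apply Rmult_lt_0_compat; [apply lt_0_INR; lia|apply pow_lt; auto].
    - lra. }
  assert (Hi2 : wcol 0 i * (t i - mu) ^ 2 <= 0).
  { eapply Rle_trans; [|apply Hsum].
    apply (rsum_term_le m (fun i => wcol 0 i * (t i - mu) ^ 2)); [|auto].
    intros j Hj. simpl wcol. pose proof (pow2_ge_0 (t j - mu)). lra. }
  simpl in Hi2. nra.
Qed.

(** The terms ln W_(k+1) of consecutive levels cancel, since q / q^(k+2) = 1 / q^(k+1); only the
    first and the last survive. *)
Lemma gap_telescope n :
  ln (rsum m t) + sum_f_R0 (fun k => gap k / INR q ^ S k) n =
  INR q * (INR q - 1) * sum_f_R0 (fun k => ln (asum k) / INR q ^ (k + 2)) n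
   + ln (Wdot (S n)) / INR q ^ S n.
Proof.
  pose proof INR_q_ge.
  assert (H0 : rsum m t = Wdot 0) by (apply rsum_ext; intros; simpl; ring).
  rewrite H0. induction n as [|n IH].
  - simpl sum_f_R0. unfold gap. simpl pow. field. lra.
  - rewrite !tech5, <- Rplus_assoc, IH. unfold gap.
    assert (INR q ^ n <> 0) by (apply pow_nonzero; lra).
    replace (S n + 2)%nat with (S (S (S n))) by lia. simpl pow. field. lra.
Qed.

Lemma Wdot_tail_cv : Un_cv (fun n => ln (Wdot (S n)) / INR q ^ S n) 0.
Proof.
  pose proof INR_q_ge as Hq2. pose proof ln_m_pos as Hl. pose proof INR_m_ge as Hm2.
  pose proof (linear_over_exp_cv q 2 hq) as H. apply Un_cv_S in H.
  intros e He. destruct (H (e / ln (INR m)) ltac:(apply Rdiv_lt_0_compat; auto)) as [N HN].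
  exists N. intros n Hn. specialize (HN n Hn). unfold Rdist in *. rewrite Rminus_0_r in *.
  pose proof (Wdot_bounds (S n)) as [HW1 HW2].
  assert (0 < INR q ^ S n) by (apply pow_lt; lra).
  assert (H1 : 0 <= ln (Wdot (S n))) by (rewrite <- ln_1; apply ln_le_mono; lra).
  assert (H2 : ln (Wdot (S n)) <= (INR (S n) + 2) * ln (INR m)).
  { apply ln_le_mono in HW2; [|lra]. rewrite ln_pow_nat in HW2 by lra. rewrite !S_INR in HW2.
    rewrite S_INR. lra. }
  assert (Hi : 0 < / INR q ^ S n) by (apply Rinv_0_lt_compat; auto).
  rewrite Rabs_pos_eq in HN.
  2:{ unfold Rdiv. apply Rmult_le_pos; [pose proof (pos_INR (S n)); lra|lra]. }
  rewrite Rabs_pos_eq by (unfold Rdiv; apply Rmult_le_pos; lra).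
  apply Rle_lt_trans with ((INR (S n) + 2) / INR q ^ S n * ln (INR m)).
  - unfold Rdiv. rewrite (Rmult_assoc (INR (S n) + 2)), (Rmult_comm (/ _)), <- Rmult_assoc.
    apply Rmult_le_compat_r; lra.
  - apply Rmult_lt_reg_r with (/ ln (INR m)); [apply Rinv_0_lt_compat; auto|].
    rewrite Rmult_assoc, Rinv_r, Rmult_1_r by lra. exact HN.
Qed.

(** With constant row sum r, the equation at a maximal and at a minimal coordinate gives t_max^(q-1)
    <= r <= t_min^(q-1). Conversely, a constant t = c forces r = c^(q-1). *)
Lemma rows_const_t_const :
  (exists lam, forall i, (i < m)%nat -> rsum m (fun j => INR (A i j) * 1) = lam * 1) <->
  (forall i j, (i < m)%nat -> (j < m)%nat -> t i = t j).
Proof.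
  split.
  - intros [r Hr].
    assert (Hr' : forall i, (i < m)%nat -> forall c, rsum m (fun j => INR (A i j) * c) = r * c).
    { intros i Hi c. replace (r * c) with (c * (r * 1)) by ring. rewrite <- (Hr i Hi), <- rsum_scal.
      apply rsum_ext. intros. ring. }
    destruct (argmax_exists m t ltac:(lia)) as [i0 [Hi0 Hmax]].
    destruct (argmax_exists m (fun i => - t i) ltac:(lia)) as [i1 [Hi1 Hmin]].
    simpl in Hmin.
    destruct (ht i0 Hi0) as [H0 E0]. destruct (ht i1 Hi1) as [H1 E1].
    destruct q as [|q'] eqn:Eq; [lia|]. simpl pow in E0, E1.
    assert (Hle0 : t i0 * t i0 ^ q' <= r * t i0).
    { rewrite E0, <- (Hr' i0 Hi0). apply rsum_le. intros j Hj.
      apply Rmult_le_compat_l; [apply pos_INR|auto]. }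
    assert (Hle1 : r * t i1 <= t i1 * t i1 ^ q').
    { rewrite E1, <- (Hr' i1 Hi1). apply rsum_le. intros j Hj.
      apply Rmult_le_compat_l; [apply pos_INR|]. specialize (Hmin j Hj). lra. }
    assert (Hle : t i0 ^ q' <= t i1 ^ q').
    { apply Rle_trans with r.
      - apply Rmult_le_reg_l with (t i0); lra.
      - apply Rmult_le_reg_l with (t i1); lra. }
    assert (Hmm : t i0 <= t i1).
    { apply Rnot_lt_le. intros Hlt.
      assert (t i1 ^ q' < t i0 ^ q'); [|lra].
      destruct q' as [|q']; [lia|]. simpl.
      assert (t i1 ^ q' <= t i0 ^ q') by (apply pow_incr; lra).
      assert (0 < t i1 ^ q') by (apply pow_lt; lra). nra. }
    intros i j Hi Hj. pose proof (Hmax i Hi). pose proof (Hmax j Hj).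
    pose proof (Hmin i Hi). pose proof (Hmin j Hj). lra.
  - intros Hc. exists (t 0%nat ^ q / t 0%nat). intros i Hi.
    destruct (ht 0%nat ltac:(lia)) as [H0 _]. destruct (ht i Hi) as [H1 E1].
    apply Rmult_eq_reg_l with (t 0%nat); [|lra]. rewrite <- rsum_scal.
    replace (t 0%nat * (t 0%nat ^ q / t 0%nat * 1)) with (t 0%nat ^ q) by (field; lra).
    transitivity (t i ^ q); [|rewrite (Hc i 0%nat) by (auto; lia); reflexivity].
    rewrite E1. apply rsum_ext. intros j Hj.
    rewrite (Hc 0%nat j) by (auto; lia). ring.
Qed.

Lemma t_const_gap k : (forall i j, (i < m)%nat -> (j < m)%nat -> t i = t j) -> gap k = 0.
Proof.
  intros Hc. set (c := t 0%nat). destruct (ht 0%nat ltac:(lia)) as [H0 _]. fold c in H0.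
  pose proof (asum_bounds k) as Ha.
  assert (HW : Wdot k = c * asum k).
  { rewrite <- wcol_sum, <- rsum_scal. apply rsum_ext. intros j Hj.
    rewrite (Hc j 0%nat) by (auto; lia). fold c. ring. }
  assert (HWS : Wdot (S k) = c ^ q * asum k).
  { rewrite Wdot_S, <- wcol_sum, <- rsum_scal. apply rsum_ext. intros j Hj.
    rewrite (Hc j 0%nat) by (auto; lia). fold c. ring. }
  unfold gap. rewrite HW, HWS, !ln_mult, ln_pow_nat; try lra. apply pow_lt; lra.
Qed.

(** The equation on the left is dim_H = dim_M with common factors removed. By [gap_telescope] its
    sides differ by the sum of the weighted gaps; these are nonnegative, so equality kills the first
    one. *)
Lemma dims_eq_iff S :
  infinite_sum (fun n => ln (asum n) / INR q ^ (n + 2)) S ->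
  (ln (rsum m t) = INR q * (INR q - 1) * S <->
   exists lam, forall i, (i < m)%nat -> rsum m (fun j => INR (A i j) * 1) = lam * 1).
Proof.
  intros HS. pose proof INR_q_ge as Hq2. rewrite rows_const_t_const.
  assert (Hlim : Un_cv (fun n => sum_f_R0 (fun k => gap k / INR q ^ Datatypes.S k) n)
    (INR q * (INR q - 1) * S + 0 - ln (rsum m t))).
  { pose proof (CV_minus _ _ _ _
      (CV_plus _ _ _ _ (CV_mult _ _ _ _ (Un_cv_const (INR q * (INR q - 1))) HS) Wdot_tail_cv)
      (Un_cv_const (ln (rsum m t)))) as H.
    intros e He. destruct (H e He) as [N HN]. exists N. intros n Hn. specialize (HN n Hn).
    cbv beta in HN. rewrite <- gap_telescope in HN.
    replace (sum_f_R0 (fun k => gap k / INR q ^ Datatypes.S k) n) with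
     (ln (rsum m t) + sum_f_R0 (fun k => gap k / INR q ^ Datatypes.S k) n - ln (rsum m t)) by ring.
    exact HN. }
  split.
  - intros Heq. apply gap_0_eq.
    replace (INR q * (INR q - 1) * S + 0 - ln (rsum m t)) with 0 in Hlim by lra.
    apply Rle_antisym; [|apply gap_nonneg].
    apply Rnot_lt_le. intros Hpos.
    destruct (Hlim (gap 0 / INR q) ltac:(apply Rdiv_lt_0_compat; lra)) as [N HN].
    specialize (HN N (le_n N)). unfold Rdist in HN. rewrite Rminus_0_r in HN.
    assert (Hge : gap 0 / INR q <= sum_f_R0 (fun k => gap k / INR q ^ Datatypes.S k) N).
    { clear HN. induction N as [|N IH]; [simpl; rewrite Rmult_1_r; lra|]. rewrite tech5.
      assert (0 <= gap (Datatypes.S N) / INR q ^ Datatypes.S (Datatypes.S N)); [|lra].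
      unfold Rdiv. apply Rmult_le_pos; [apply gap_nonneg|].
      left. apply Rinv_0_lt_compat. apply pow_lt. lra. }
    pose proof (Rle_abs (sum_f_R0 (fun k => gap k / INR q ^ Datatypes.S k) N)). lra.
  - intros Hc.
    assert (Hz : Un_cv (fun n => sum_f_R0 (fun k => gap k / INR q ^ Datatypes.S k) n) 0).
    { intros e He. exists 0%nat. intros n _. rewrite (sum_eq _ (fun _ => 0)).
      - rewrite sum_cte, Rmult_0_l, Rdist_eq. auto.
      - intros k _. rewrite t_const_gap by auto. unfold Rdiv. ring. }
    pose proof (UL_sequence _ _ _ Hlim Hz). lra.
Qed.

End Compare.
End Matrix.

(** * Scales and cylinders *)

Section Scales.
Variable m : nat.

Lemma diam_agree U r n x y :
  diam_le m U r -> (forall j, (j < n)%nat -> r < (/ INR m) ^ j) -> U x -> U y -> agree n x y.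
Proof.
  intros HU Hr Hx Hy. induction n as [|n IH]; [intros k Hk; lia|].
  assert (Hag : agree n x y) by auto. apply agree_S. split; [auto|].
  apply NNPP. intros Hne. specialize (Hr n ltac:(lia)).
  assert ((/ INR m) ^ n <= r); [|lra].
  apply (HU x y Hx Hy). right. exists n. auto.
Qed.

Hypothesis hm : (2 <= m)%nat.

Lemma inv_m_bounds : 0 < / INR m < 1.
Proof.
  pose proof (INR_m_ge m hm). split; [apply Rinv_0_lt_compat; lra|].
  rewrite <- Rinv_1. apply Rinv_lt_contravar; lra.
Qed.

Lemma inv_m_pow_pos n : 0 < (/ INR m) ^ n.
Proof. apply pow_lt. apply inv_m_bounds. Qed.

Lemma inv_m_pow_le n k : (n <= k)%nat -> (/ INR m) ^ k <= (/ INR m) ^ n.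
Proof.
  intros H. pose proof inv_m_bounds. induction H as [|k H IH]; [lra|].
  simpl. pose proof (inv_m_pow_pos k). nra.
Qed.

(** The first n with m^-n <= r. A set of diameter at most r lies in one cylinder of length n, by
    [diam_agree], and such a cylinder has diameter at most r: passing to cylinders costs nothing. *)
Lemma scale_exists r : 0 < r ->
  exists n, (/ INR m) ^ n <= r /\ forall j, (j < n)%nat -> r < (/ INR m) ^ j.
Proof.
  intros Hr. pose proof inv_m_bounds.
  destruct (pow_lt_1_zero (/ INR m) ltac:(rewrite Rabs_pos_eq; lra) r Hr) as [N HN].
  specialize (HN N (le_n N)). rewrite Rabs_pos_eq in HN by (left; apply inv_m_pow_pos).
  apply Rlt_le in HN. revert HN. induction N as [N IH] using (well_founded_induction lt_wf).
  intros HN. destruct (classic (exists j, (j < N)%nat /\ (/ INR m) ^ j <= r)) as [[j [Hj Hjr]]|Hno].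
  - apply (IH j); auto.
  - exists N. split; [auto|]. intros j Hj. apply Rnot_le_lt. intros Hle. apply Hno. eauto.
Qed.

Lemma cylinder_diam (U : (nat -> nat) -> Prop) n w :
  (forall x, U x -> agree n x w) -> diam_le m U ((/ INR m) ^ n).
Proof.
  intros HU x y Hx Hy d [[_ ->]|[k [_ [Hk ->]]]].
  - left. apply inv_m_pow_pos.
  - apply inv_m_pow_le. apply Nat.nlt_ge. intros Hlt. apply Hk.
    rewrite (HU x Hx k Hlt), (HU y Hy k Hlt). reflexivity.
Qed.

End Scales.

(** * Admissible words *)

Lemma rsum_S_l n f : rsum (S n) f = f 0%nat + rsum n (fun i => f (S i)).
Proof.
  induction n as [|n IH]; [simpl; ring|].
  change (rsum (S (S n)) f) with (rsum (S n) f + f (S n)). rewrite IH. simpl. ring.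
Qed.

Lemma rsum_sum_f_R0 f n : rsum (S n) f = sum_f_R0 f n.
Proof. induction n as [|n IH]; [simpl; ring|]. rewrite tech5, <- IH. reflexivity. Qed.

Definition gprod (G : nat -> nat -> R) : nat -> (nat -> nat) -> R :=
  fix g n x := match n with O => 1 | S n' => g n' x * G n' (x n') end.

Lemma gprod_agree G n x y : agree n x y -> gprod G n x = gprod G n y.
Proof.
  induction n as [|n IH]; intros H; [reflexivity|]. apply agree_S in H. destruct H as [H1 H2].
  simpl. rewrite IH, H2 by auto. reflexivity.
Qed.

Lemma gprod_ext G G' n x :
  (forall k, (k < n)%nat -> G k (x k) = G' k (x k)) -> gprod G n x = gprod G' n x.
Proof.
  induction n as [|n IH]; intros H; [reflexivity|]. simpl. rewrite IH, H by auto. reflexivity.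
Qed.

Lemma gprod_mult_at G G' n x p c :
  (p < n)%nat -> (forall k, (k < n)%nat -> k <> p -> G k (x k) = G' k (x k)) ->
  G' p (x p) = G p (x p) * c -> gprod G' n x = gprod G n x * c.
Proof.
  intros Hp HG HGp. induction n as [|n IH]; [lia|]. simpl.
  destruct (Nat.eq_dec p n) as [->|Hne].
  - rewrite HGp, (gprod_ext G' G); [ring|]. intros k Hk. symmetry. apply HG; lia.
  - rewrite IH by (try lia; intros; apply HG; lia). rewrite <- (HG n) by lia. ring.
Qed.

(** The number of indices k <= n that q does not divide, that is, of chains started so far. *)
Definition hcount (q n : nat) : nat := (n - n / q)%nat.

Section Admissible.
Variables (m q : nat) (A : nat -> nat -> nat).
Definition adm (n : nat) (x : nat -> nat) : Prop :=
  forall k, (1 <= k)%nat -> (q * k <= n)%nat -> A (x (k - 1)%nat) (x (q * k - 1)%nat) = 1%nat.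

Lemma adm_le n n' x : (n' <= n)%nat -> adm n x -> adm n' x.
Proof. intros Hn H k Hk Hqk. apply H; lia. Qed.

Hypothesis hq : (2 <= q)%nat.

Lemma adm_agree n x y : agree n x y -> adm n x -> adm n y.
Proof.
  intros H Hx k Hk Hqk. rewrite <- !H by nia. auto.
Qed.

Lemma adm_S n x :
  adm (S n) x <-> adm n x /\ ((S n mod q = 0)%nat -> A (x (S n / q - 1)%nat) (x n) = 1%nat).
Proof.
  split.
  - intros H. split; [apply (adm_le (S n)); auto|]. intros Hd.
    destruct (parent_lt q hq n Hd) as [_ [H1 H2]].
    specialize (H (S n / q)%nat H1 ltac:(lia)). rewrite <- H2 in H.
    simpl in H. rewrite Nat.sub_0_r in H. exact H.
  - intros [H1 H2] k Hk Hqk. destruct (Nat.eq_dec (q * k) (S n)) as [He|Hne]; [|apply H1; lia].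
    assert (Hd : (S n mod q = 0)%nat) by (rewrite <- He, Nat.mul_comm; apply Nat.Div0.mod_mul).
    specialize (H2 Hd). rewrite <- He in H2 at 1. rewrite Nat.mul_comm, Nat.div_mul in H2 by lia.
    rewrite He. simpl. rewrite Nat.sub_0_r. exact H2.
Qed.

Lemma X_A_adm x : X_A m q A x <-> in_Sigma m x /\ forall n, adm n x.
Proof.
  split; intros [H1 H2]; split; auto.
  - intros n k Hk _. auto.
  - intros k Hk. apply (H2 (q * k)%nat); auto.
Qed.

Lemma hcount_S_dvd n : (S n mod q = 0)%nat -> hcount q (S n) = hcount q n.
Proof. intros H. unfold hcount. rewrite div_S_dvd by auto. lia. Qed.

Lemma hcount_S_ndvd n : (S n mod q <> 0)%nat -> hcount q (S n) = S (hcount q n).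
Proof.
  intros H. unfold hcount. rewrite div_S_ndvd by auto. pose proof (div_le_self q n hq). lia.
Qed.

Lemma hcount_mono n n' : (n <= n')%nat -> (hcount q n <= hcount q n')%nat.
Proof.
  intros H. induction H as [|n' H IH]; [auto|].
  destruct (Nat.eq_dec (S n' mod q) 0); [rewrite hcount_S_dvd|rewrite hcount_S_ndvd]; auto.
Qed.

Hypothesis hm : (2 <= m)%nat.
Hypothesis h01 : zero_one m A.
Hypothesis hprim : primitive_mx m A.

(** Every row of A is nonzero, so an admissible word never gets stuck: counting admissible words is
    counting the cylinders that meet X_A. *)
Lemma adm_extend n x :
  in_Sigma m x -> adm n x -> exists y, X_A m q A y /\ agree n y x.
Proof.
  intros Hx Ha.
  destruct (infinite_branch m adm) with (n0 := n) (x0 := x) as [y [Hy [Hag Hn]]]; auto.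
  - intros; eapply adm_agree; eauto.
  - intros k z Hz Hadm.
    assert (Hgo : exists a, (a < m)%nat /\ ((S k mod q = 0)%nat -> A (z (S k / q - 1)%nat) a = 1%nat)).
    { destruct (row_nonzero m A hm h01 hprim (z (S k / q - 1)%nat) (Hz _)) as [j [Hj HA]]. eauto. }
    destruct Hgo as [a [Ha1 Ha2]]. exists a. split; [auto|]. apply adm_S. split.
    + apply (adm_agree k z); [apply agree_sym, agree_upd|auto].
    + intros Hd. rewrite upd_eq. rewrite upd_neq; [auto|].
      apply parent_lt in Hd; [lia|auto].
  - exists y. split; [|auto]. apply X_A_adm. split; [auto|]. intros k.
    apply (adm_le (max n k)); [lia|]. apply Hn. lia.
Qed.

(** * Counting admissible words *)

Definition ctau (i a : nat) : R := INR (A i a).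
Local Notation Ec := (wsum m q (fun _ => 1) ctau).
Local Notation kc := (kern q (fun _ => 1) ctau).

Lemma count_wt n x : in_Sigma m x -> wt q (fun _ => 1) ctau n x = indic (adm n x).
Proof.
  intros Hx. induction n as [|n IH].
  - simpl. rewrite indic_true; [reflexivity|]. intros k Hk Hqk. nia.
  - simpl. rewrite IH. unfold kern.
    destruct (Nat.eqb_spec (S n mod q) 0) as [Hd|Hd].
    + unfold ctau. destruct (h01 (x (S n / q - 1)%nat) (x n) (Hx _) (Hx _)) as [HA|HA]; rewrite HA.
      * rewrite (indic_false (adm (S n) x)); [simpl; ring|]. intros H. apply adm_S in H.
        destruct H as [_ H]. specialize (H Hd). lia.
      * simpl. rewrite Rmult_1_r. apply indic_iff. rewrite adm_S. tauto.
    + rewrite Rmult_1_r. apply indic_iff. rewrite adm_S. tauto.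
Qed.

Lemma ctau_nonneg : forall i a, (i < m)%nat -> (a < m)%nat -> 0 <= ctau i a.
Proof. intros. apply pos_INR. Qed.

Local Notation v := (vrow m A).
Local Notation a := (asum m A).

(* [Zcount r n] counts admissible words of length n whose last-generation letters carry
   r further generations of descendants. *)
Definition Zcount (r n : nat) : R :=
  Ec n (gprod (fun k i => if Nat.leb (n / q) k then v r i else 1) n).

(* Weights once the letters at positions >= j have been summed out. *)
Definition Gpart (r n j k i : nat) : R :=
  if Nat.leb (n / q) k then v r i
  else if Nat.ltb j (q * S k) then v (S r) i else 1.

(** If q divides j + 1, the sum over the last letter is sum_b A(x_p,b) v_r(b) = v_(r+1)(x_p), which
    raises the weight of its parent p. Otherwise the letter is free and the sum is a_r. *)
Lemma Gpart_step r n j :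
  (n / q <= j)%nat -> (j < n)%nat ->
  Ec (S j) (gprod (Gpart r n (S j)) (S j)) =
  (if Nat.eqb (S j mod q) 0 then 1 else a r) * Ec j (gprod (Gpart r n j) j).
Proof.
  intros Hj1 Hj2. rewrite wsum_S by auto. rewrite <- wsum_scal. apply wsum_ext; [lia|]. intros x Hx.
  assert (Hlast : forall b, Gpart r n (S j) j b = v r b).
  { intros b. unfold Gpart. apply Nat.leb_le in Hj1. rewrite Hj1. reflexivity. }
  rewrite (rsum_ext m _ (fun b => gprod (Gpart r n (S j)) j x * (kc x j b * v r b))).
  2:{ intros b _. simpl gprod. rewrite upd_eq, Hlast, (gprod_agree _ j _ x) by apply agree_upd. ring. }
  rewrite rsum_scal.
  destruct (Nat.eqb_spec (S j mod q) 0) as [Hd|Hd].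
  - destruct (parent_lt q hq j Hd) as [Hp1 [Hp2 Hp3]].
    rewrite (rsum_ext m _ (fun b => INR (A (x (S j / q - 1)%nat) b) * v r b)).
    2:{ intros b _. unfold kern. rewrite (proj2 (Nat.eqb_eq _ _) Hd). reflexivity. }
    set (p := (S j / q - 1)%nat) in *.
    assert (Hpn : (p < n / q)%nat).
    { assert (p + 1 <= n / q)%nat; [|lia]. apply Nat.div_le_lower_bound; [lia|].
      unfold p. nia. }
    rewrite Rmult_1_l. symmetry. apply (gprod_mult_at _ _ j x p); [auto| |].
    + intros k Hk Hkp. unfold Gpart. destruct (Nat.leb_spec (n / q) k); [reflexivity|].
      destruct (Nat.ltb_spec j (q * S k)); destruct (Nat.ltb_spec (S j) (q * S k));
        try reflexivity; try lia.
      exfalso. apply Hkp. assert (q * S k = S j)%nat by lia.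
      unfold p. rewrite <- H2, Nat.mul_comm, Nat.div_mul by lia. lia.
    + unfold Gpart. destruct (Nat.leb_spec (n / q) p); [lia|].
      replace (q * S p)%nat with (S j) by (unfold p; nia).
      destruct (Nat.ltb_spec j (S j)); [|lia]. destruct (Nat.ltb_spec (S j) (S j)); [lia|].
      rewrite vrow_S. unfold Aop. ring.
  - rewrite (rsum_ext m _ (v r)).
    2:{ intros b _. unfold kern. rewrite (proj2 (Nat.eqb_neq _ _) Hd). ring. }
    rewrite <- asum_vrow, Rmult_comm by auto. f_equal. apply gprod_ext. intros k Hk.
    unfold Gpart. destruct (Nat.leb_spec (n / q) k); [reflexivity|].
    destruct (Nat.ltb_spec j (q * S k)); destruct (Nat.ltb_spec (S j) (q * S k));
      try reflexivity; try lia.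
    exfalso. apply Hd. assert (He : (S j = S k * q)%nat) by lia. rewrite He. apply Nat.Div0.mod_mul.
Qed.

(** Letters at positions n/q, ..., n-1 are summed out from the end, with one factor a_r per chain
    start among them. What is left carries the weights of [Zcount (S r) (n / q)]. *)
Lemma Zcount_rec r n : Zcount r n = a r ^ (hcount q n - hcount q (n / q)) * Zcount (S r) (n / q).
Proof.
  assert (Hgo : forall d, (n / q + d <= n)%nat ->
    Ec (n / q + d) (gprod (Gpart r n (n / q + d)) (n / q + d)) =
    a r ^ (hcount q (n / q + d) - hcount q (n / q)) * Ec (n / q) (gprod (Gpart r n (n / q)) (n / q))).
  { induction d as [|d IH]; intros Hd.
    - rewrite Nat.add_0_r, Nat.sub_diag. simpl. ring.
    - rewrite Nat.add_succ_r, Gpart_step, IH by lia.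
      pose proof (hcount_mono (n / q) (n / q + d) ltac:(lia)).
      destruct (Nat.eqb_spec (S (n / q + d) mod q) 0).
      + rewrite hcount_S_dvd by auto. ring.
      + rewrite hcount_S_ndvd, Nat.sub_succ_l by auto. simpl. ring. }
  pose proof (div_le_self q n hq) as Hle.
  specialize (Hgo (n - n / q)%nat ltac:(lia)).
  replace (n / q + (n - n / q))%nat with n in Hgo by lia.
  unfold Zcount. transitivity (Ec n (gprod (Gpart r n n) n)); [|rewrite Hgo; f_equal].
  - apply wsum_ext; [lia|]. intros x _. apply gprod_ext. intros k Hk. unfold Gpart.
    destruct (Nat.leb_spec (n / q) k); [reflexivity|].
    destruct (Nat.ltb_spec n (q * S k)); [|reflexivity].
    pose proof (Nat.Div0.mul_div_le n q). nia.
  - apply wsum_ext; [lia|]. intros x _. apply gprod_ext. intros k Hk. unfold Gpart.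
    destruct (Nat.leb_spec (n / q) k); [lia|].
    destruct (Nat.ltb_spec (n / q) (q * S k)) as [H1|H1];
      destruct (Nat.leb_spec (n / q / q) k) as [H2|H2]; try reflexivity; exfalso.
    + assert (n / q / q < S k)%nat; [|lia]. apply Nat.Div0.div_lt_upper_bound. auto.
    + assert (S k <= n / q / q)%nat; [|lia]. apply Nat.div_le_lower_bound; lia.
Qed.

Lemma Zcount_0 r : Zcount r 0 = 1.
Proof. unfold Zcount, wsum. simpl. ring. Qed.

Lemma Zcount_count n : Zcount 0 n = Ec n (fun _ => 1).
Proof.
  apply wsum_ext; [lia|]. intros x _. induction n as [|n IH]; [reflexivity|].
  transitivity (gprod (fun _ _ => 1) (S n) x).
  - apply gprod_ext. intros k _. unfold vrow. simpl. destruct Nat.leb; reflexivity.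
  - generalize (S n) as k. induction k as [|k IHk]; [reflexivity|]. simpl. rewrite IHk. ring.
Qed.

Lemma Zcount_ln_rec r n : 1 <= Zcount (S r) (n / q) ->
  ln (Zcount r n) = INR (hcount q n - hcount q (n / q)) * ln (a r) + ln (Zcount (S r) (n / q)).
Proof.
  intros H. pose proof (asum_bounds m A hm h01 hprim r).
  rewrite Zcount_rec, ln_mult, ln_pow_nat; [reflexivity|lra|apply pow_lt; lra|lra].
Qed.

(** A priori bound for the remainder of the iterated recursion: r grows by 1 while n shrinks to k =
    n/q, and (n - k)(r + 1) + k (r + 3) <= n (r + 2) because 2k <= n. *)
Lemma Zcount_bounds r n : 1 <= Zcount r n /\ ln (Zcount r n) <= (INR r + 2) * INR n * ln (INR m).
Proof.
  revert r. induction n as [n IH] using (well_founded_induction lt_wf). intros r.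
  destruct (Nat.eq_dec n 0) as [->|Hn].
  { rewrite Zcount_0, ln_1. simpl. lra. }
  assert (Hlt : (n / q < n)%nat) by (apply Nat.div_lt; lia).
  destruct (IH _ Hlt (S r)) as [H1 H2].
  pose proof (asum_bounds m A hm h01 hprim r) as Ha.
  pose proof (ln_asum_bounds m A hm h01 hprim r) as Hla.
  pose proof (ln_m_pos m hm) as Hl.
  split.
  - rewrite Zcount_rec. assert (1 <= a r ^ (hcount q n - hcount q (n / q))).
    { apply pow_R1_Rle. lra. } nra.
  - rewrite Zcount_ln_rec by auto.
    assert (Hc : (hcount q n - hcount q (n / q) <= n - n / q)%nat) by (unfold hcount; lia).
    apply le_INR in Hc. rewrite (minus_INR n (n / q)) in Hc by lia.
    pose proof (pos_INR (hcount q n - hcount q (n / q))) as Hc0.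
    assert (Hhalf : 2 * INR (n / q) <= INR n).
    { rewrite <- (mult_INR 2). apply le_INR. pose proof (Nat.Div0.mul_div_le n q). nia. }
    set (c := INR (hcount q n - hcount q (n / q))) in *. set (k := INR (n / q)) in *.
    rewrite S_INR in *. pose proof (pos_INR r). pose proof (pos_INR (n / q)) as Hk. fold k in Hk.
    assert (c * ln (a r) <= (INR n - k) * ((INR r + 1) * ln (INR m))).
    { apply Rmult_le_compat; try lra. }
    set (l := ln (INR m)) in *. assert (2 * k * l <= INR n * l) by (apply Rmult_le_compat_r; lra).
    lra.
Qed.

Lemma hcount_approx n :
  Rabs (INR (hcount q n - hcount q (n / q)) - INR n * ((INR q - 1) ^ 2 / INR q ^ 2)) <= 2.
Proof.
  pose proof (div_le_self q n hq) as H1. pose proof (div_le_self q (n / q) hq) as H2.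
  rewrite minus_INR by (apply hcount_mono; auto). unfold hcount. rewrite !minus_INR by auto.
  pose proof (INR_div_bounds q n hq) as B1. pose proof (INR_div_bounds q (n / q) hq) as B2.
  assert (Hq2 : 2 <= INR q) by (apply (le_INR 2); auto).
  set (k := INR (n / q)) in *. set (k2 := INR (n / q / q)) in *. set (N := INR n) in *.
  assert (Hi : 0 < / INR q <= / 2).
  { split; [apply Rinv_0_lt_compat; lra|apply Rinv_le_contravar; lra]. }
  replace (N * ((INR q - 1) ^ 2 / INR q ^ 2)) with (N - 2 * (N / INR q) + N / INR q / INR q)
    by (field; lra).
  assert (B3 : N / INR q / INR q - 1 <= k / INR q <= N / INR q / INR q).
  { unfold Rdiv in *. set (i := / INR q) in *. split; nra. }
  apply Rabs_le. lra.
Qed.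

(** The recursion unrolled D times. [K] may depend on D but not on n and absorbs the rounding; the
    last term is [Zcount_bounds] at length about n/q^D. *)
Lemma ln_Zcount_approx D r : exists K, 0 <= K /\ forall n,
  Rabs (ln (Zcount r n) - INR n * ((INR q - 1) ^ 2 * rsum D (fun d => ln (a (r + d)) / INR q ^ (d + 2))))
   <= K + (INR (r + D) + 2) * ln (INR m) * (INR n / INR q ^ D).
Proof.
  pose proof (ln_m_pos m hm) as Hl.
  assert (Hq2 : 2 <= INR q) by (apply (le_INR 2); auto).
  revert r. induction D as [|D IH]; intros r.
  - exists 0. split; [lra|]. intros n. simpl rsum.
    destruct (Zcount_bounds r n) as [H1 H2].
    assert (0 <= ln (Zcount r n)) by (rewrite <- ln_1; apply ln_le_mono; lra).
    rewrite Nat.add_0_r, !Rmult_0_r, Rminus_0_r, Rabs_pos_eq by auto. simpl. lra.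
  - destruct (IH (S r)) as [K [HK HKn]].
    set (X := (INR q - 1) ^ 2 * rsum D (fun d => ln (a (S r + d)) / INR q ^ (d + 2))) in *.
    pose proof (ln_asum_bounds m A hm h01 hprim r) as Hla.
    exists (K + Rabs X + 2 * ln (a r)). split; [pose proof (Rabs_pos X); lra|]. intros n.
    rewrite Zcount_ln_rec by apply Zcount_bounds.
    pose proof (hcount_approx n) as Hh. specialize (HKn (n / q)%nat).
    pose proof (INR_div_bounds q n hq) as Hb.
    assert (HX : (INR q - 1) ^ 2 * rsum (S D) (fun d => ln (a (r + d)) / INR q ^ (d + 2))
       = (INR q - 1) ^ 2 / INR q ^ 2 * ln (a r) + X / INR q).
    { rewrite rsum_S_l, Rmult_plus_distr_l, Nat.add_0_r. unfold X. f_equal.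
      - simpl. field. lra.
      - unfold Rdiv. rewrite Rmult_assoc. f_equal. rewrite Rmult_comm, <- rsum_scal.
        apply rsum_ext. intros d _. replace (r + S d)%nat with (S r + d)%nat by lia.
        simpl. field. split; [apply pow_nonzero; lra|lra]. }
    rewrite HX. set (c := INR (hcount q n - hcount q (n / q))) in *.
    set (g := (INR q - 1) ^ 2 / INR q ^ 2) in *. set (k := INR (n / q)) in *.
    set (z := ln (Zcount (S r) (n / q))) in *.
    replace (c * ln (a r) + z - INR n * (g * ln (a r) + X / INR q)) with
      ((c - INR n * g) * ln (a r) + (z - k * X) + X * (k - INR n / INR q)) by (field; lra).
    eapply Rle_trans; [apply Rabs_triang|].
    eapply Rle_trans; [apply Rplus_le_compat_r, Rabs_triang|].
    assert (T1 : Rabs ((c - INR n * g) * ln (a r)) <= 2 * ln (a r)).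
    { rewrite Rabs_mult, (Rabs_pos_eq (ln (a r))) by lra. apply Rmult_le_compat_r; lra. }
    assert (T2 : Rabs (X * (k - INR n / INR q)) <= Rabs X).
    { rewrite Rabs_mult. rewrite <- (Rmult_1_r (Rabs X)) at 2.
      apply Rmult_le_compat_l; [apply Rabs_pos|]. apply Rabs_le. lra. }
    assert (T3 : (INR (S r + D) + 2) * ln (INR m) * (k / INR q ^ D)
       <= (INR (r + S D) + 2) * ln (INR m) * (INR n / INR q ^ S D)).
    { replace (S r + D)%nat with (r + S D)%nat by lia.
      apply Rmult_le_compat_l.
      - apply Rmult_le_pos; [pose proof (pos_INR (r + S D)); lra|lra].
      - assert (0 < / INR q ^ D) by (apply Rinv_0_lt_compat, pow_lt; lra).
        replace (INR n / INR q ^ S D) with (INR n / INR q * / INR q ^ D).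
        + apply Rmult_le_compat_r; lra.
        + simpl. field. split; [apply pow_nonzero; lra|lra]. }
    lra.
Qed.

(** Order of choices: D first, so that the tail of the series and (D + 3) / q^(D+1) are small, then
    n large enough to outweigh [K]. *)
Lemma ln_Zcount_limit S :
  infinite_sum (fun n => ln (a n) / INR q ^ (n + 2)) S ->
  forall eps, 0 < eps -> exists n0, forall n, (n0 <= n)%nat ->
    Rabs (ln (Zcount 0 n) - INR n * ((INR q - 1) ^ 2 * S)) <= eps * INR n.
Proof.
  intros HS eps He.
  pose proof (ln_m_pos m hm) as Hl.
  assert (Hq2 : 2 <= INR q) by (apply (le_INR 2); auto).
  set (g := (INR q - 1) ^ 2). assert (Hg : 0 < g) by (unfold g; nra).
  destruct (HS (eps / (3 * g)) ltac:(apply Rdiv_lt_0_compat; lra)) as [N1 HN1].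
  destruct (linear_over_exp_cv q 2 hq (eps / (3 * ln (INR m))) ltac:(apply Rdiv_lt_0_compat; lra))
    as [N2 HN2].
  set (D := max N1 N2). specialize (HN1 D ltac:(lia)). specialize (HN2 (Datatypes.S D) ltac:(lia)).
  destruct (ln_Zcount_approx (Datatypes.S D) 0) as [K [HK HKn]].
  destruct (exists_INR_ge (3 * K / eps)) as [n0 Hn0].
  exists n0. intros n Hn. apply le_INR in Hn. specialize (HKn n). simpl Nat.add in HKn.
  rewrite rsum_sum_f_R0 in HKn. fold g in HKn.
  unfold Rdist in HN1, HN2. rewrite Rminus_0_r in HN2.
  pose proof (Rle_abs ((INR (Datatypes.S D) + 2) / INR q ^ Datatypes.S D)) as Habs.
  set (P := sum_f_R0 (fun n => ln (a n) / INR q ^ (n + 2)) D) in *.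
  assert (HK3 : K <= eps / 3 * INR n).
  { replace K with (eps / 3 * (3 * K / eps)) by (field; lra). apply Rmult_le_compat_l; lra. }
  assert (HD : (INR (Datatypes.S D) + 2) * ln (INR m) * (INR n / INR q ^ Datatypes.S D) <= eps / 3 * INR n).
  { replace ((INR (Datatypes.S D) + 2) * ln (INR m) * (INR n / INR q ^ Datatypes.S D))
      with ((INR (Datatypes.S D) + 2) / INR q ^ Datatypes.S D * ln (INR m) * INR n)
      by (field; apply pow_nonzero; lra).
    apply Rmult_le_compat_r; [apply pos_INR|].
    apply Rle_trans with (eps / (3 * ln (INR m)) * ln (INR m)); [apply Rmult_le_compat_r; lra|].
    apply Req_le. field. lra. }
  assert (HP : Rabs (INR n * (g * P) - INR n * (g * S)) <= eps / 3 * INR n).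
  { replace (INR n * (g * P) - INR n * (g * S)) with ((P - S) * (g * INR n)) by ring.
    rewrite Rabs_mult, (Rabs_pos_eq (g * INR n)) by (pose proof (pos_INR n); nra).
    apply Rle_trans with (eps / (3 * g) * (g * INR n)).
    - apply Rmult_le_compat_r; [pose proof (pos_INR n); nra|lra].
    - apply Req_le. field. lra. }
  replace (ln (Zcount 0 n) - INR n * (g * S)) with
    ((ln (Zcount 0 n) - INR n * (g * P)) + (INR n * (g * P) - INR n * (g * S))) by ring.
  eapply Rle_trans; [apply Rabs_triang|]. lra.
Qed.

(** * The Minkowski dimension *)

(** The cylinders of admissible words form a cover. Conversely each of them meets X_A by
    [adm_extend], while a covering set lies in a single cylinder, so no smaller cover exists. *)
Lemma Ncover_count n delta :
  (/ INR m) ^ n <= delta -> (forall j, (j < n)%nat -> delta < (/ INR m) ^ j) ->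
  exists k, Ncover m (X_A m q A) delta k /\ INR k = Zcount 0 n.
Proof.
  intros H1 H2.
  pose (L := filter (fun x => if excluded_middle_informative (adm n x) then true else false) (words m n)).
  assert (HL : INR (length L) = Zcount 0 n).
  { rewrite Zcount_count. unfold wsum, L.
    rewrite (lsum_ext _ _ (fun x => indic (adm n x))).
    - induction (words m n) as [|x l IH]; [reflexivity|]. simpl. unfold indic at 1.
      destruct (excluded_middle_informative (adm n x)); [|rewrite IH; ring].
      rewrite length_cons, S_INR, IH. ring.
    - intros x Hx. rewrite count_wt; [ring|]. eapply words_Sigma; [|eauto]. lia. }
  exists (length L). split; [|auto]. split.
  - exists (fun i x => in_Sigma m x /\ agree n x (nth i L (fun _ => O))). split.
    + intros i _. split; [tauto|]. intros x y Hx Hy d Hd. eapply Rle_trans; [|apply H1].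
      apply (cylinder_diam m hm (fun x => agree n x (nth i L (fun _ => O))) n (nth i L (fun _ => O))) with x y;
        tauto.
    + intros x Hx. apply X_A_adm in Hx. destruct Hx as [Hx Ha].
      destruct (words_prefix m n x Hx) as [w [Hw Hag]].
      assert (Hin : In w L).
      { apply filter_In. split; [auto|]. destruct excluded_middle_informative as [_|Hn]; [auto|].
        exfalso. apply Hn. apply (adm_agree n x); [apply agree_sym; auto|auto]. }
      destruct (In_nth L w (fun _ => O) Hin) as [i [Hi Hnth]]. exists i. split; [auto|].
      split; [auto|]. rewrite Hnth. apply agree_sym. auto.
  - intros k' [U [HU Hcov]]. apply INR_le. rewrite HL, Zcount_count.
    (* A point of [U i] when there is one, otherwise any sequence: it names the only cylinder of
       length n that [U i] can meet. *)
    pose (w := fun i => epsilon (inhabits (fun _ : nat => O))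
      (fun x => in_Sigma m x /\ ((exists y, U i y) -> (i < k')%nat -> U i x))).
    assert (Hw : forall i, in_Sigma m (w i) /\ ((exists y, U i y) -> (i < k')%nat -> U i (w i))).
    { intros i. unfold w. apply epsilon_spec.
      destruct (classic ((exists y, U i y) /\ (i < k')%nat)) as [[[y Hy] Hi]|Hno].
      - exists y. split; [apply (HU i Hi); auto|auto].
      - exists (fun _ => O). split; [intros j; lia|tauto]. }
    apply Rle_trans with (Ec n (fun x => rsum k' (fun i => indic (agree n x (w i))))).
    + apply wsum_le_pos; [lia|intros; lra|apply ctau_nonneg|]. intros x Hx Hp.
      rewrite count_wt in Hp by auto.
      assert (Ha : adm n x).
      { apply NNPP. intros Hn. rewrite indic_false in Hp by auto. lra. }
      destruct (adm_extend n x Hx Ha) as [y [Hy Hag]].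
      destruct (Hcov y Hy) as [i [Hi HUi]].
      rewrite <- (indic_true (agree n x (w i))).
      * apply (rsum_term_le k' (fun i => indic (agree n x (w i)))); [|auto]. intros. apply indic_bounds.
      * apply agree_trans with y; [apply agree_sym; auto|].
        eapply diam_agree; [apply (HU i Hi)|exact H2|auto|]. apply Hw; eauto.
    + rewrite wsum_rsum, <- (Rmult_1_r (INR k')), <- rsum_const. apply rsum_le. intros i Hi.
      eapply Rle_trans; [apply wsum_cylinder; [auto|lia|intros; lra|apply ctau_nonneg|apply Hw]|].
      rewrite count_wt by apply Hw. apply indic_bounds.
Qed.

Lemma Minkowski_X_A S :
  infinite_sum (fun n => ln (a n) / INR q ^ (n + 2)) S ->
  MinkowskiDim m (X_A m q A) ((INR q - 1) ^ 2 * (S / ln (INR m))).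
Proof.
  intros HS eps He. pose proof (ln_m_pos m hm) as Hl. pose proof (INR_m_ge m hm) as Hm2.
  set (l := ln (INR m)) in *. set (dm := (INR q - 1) ^ 2 * (S / l)).
  assert (HSl : (INR q - 1) ^ 2 * S = dm * l) by (unfold dm; field; lra).
  (* Two errors of size eps l n / 8, one from counting and one from the gap between delta and m^-n,
     are compared with eps y, where y >= n l / 2. *)
  destruct (ln_Zcount_limit S HS (eps * l / 8) ltac:(nra)) as [n0 Hn0]. rewrite HSl in Hn0.
  destruct (exists_INR_ge (8 * Rabs dm / eps)) as [n1 Hn1].
  (* The 2 ensures n - 1 >= n/2, hence the lower bound on [- ln delta]. *)
  set (n2 := max (max n0 n1) 2).
  exists ((/ INR m) ^ n2). split; [apply (inv_m_pow_pos m hm)|]. intros delta [Hd0 Hd1].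
  destruct (scale_exists m hm delta Hd0) as [n [H1 H2]].
  assert (Hn : (n2 < n)%nat).
  { apply Nat.nle_gt. intros Hle. pose proof (inv_m_pow_le m hm n n2 Hle). lra. }
  destruct (Ncover_count n delta H1 H2) as [k [Hk HkZ]]. exists k. split; [auto|].
  rewrite HkZ. specialize (Hn0 n ltac:(lia)).
  assert (Hln : forall j, ln ((/ INR m) ^ j) = - (INR j * l)).
  { intros j. rewrite ln_pow_nat by apply (inv_m_bounds m hm). rewrite ln_Rinv by lra. unfold l. ring. }
  assert (Hy1 : - ln delta <= INR n * l).
  { apply ln_le_mono in H1; [|apply (inv_m_pow_pos m hm)]. rewrite Hln in H1. lra. }
  assert (Hy2 : (INR n - 1) * l <= - ln delta).
  { specialize (H2 (n - 1)%nat ltac:(lia)). apply ln_increasing in H2; [|auto].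
    rewrite Hln, minus_INR in H2 by lia. simpl in H2. lra. }
  set (y := - ln delta) in *. set (zl := ln (Zcount 0 n)) in *.
  assert (HnR1 : INR n1 <= INR n) by (apply le_INR; lia).
  assert (HnR2 : 2 <= INR n) by (apply (le_INR 2); lia).
  assert (Hdm : Rabs dm <= eps * INR n / 8).
  { replace (Rabs dm) with (eps * (8 * Rabs dm / eps) / 8) by (field; lra).
    apply Rmult_le_compat_r; [lra|]. apply Rmult_le_compat_l; lra. }
  assert (Hy : INR n * l / 2 <= y) by nra.
  assert (Hypos : 0 < y) by nra.
  replace (zl / y - dm) with ((zl - dm * y) / y) by (field; lra).
  unfold Rdiv. rewrite Rabs_mult, (Rabs_pos_eq (/ y)) by (left; apply Rinv_0_lt_compat; auto).
  apply Rmult_lt_reg_r with y; [auto|]. rewrite Rmult_assoc, Rinv_l, Rmult_1_r by lra.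
  replace (zl - dm * y) with ((zl - INR n * (dm * l)) + dm * (INR n * l - y)) by ring.
  eapply Rle_lt_trans; [apply Rabs_triang|].
  assert (T : Rabs (dm * (INR n * l - y)) <= eps * INR n / 8 * l).
  { rewrite Rabs_mult, (Rabs_pos_eq (INR n * l - y)) by lra.
    apply Rmult_le_compat; [apply Rabs_pos|lra|auto|lra]. }
  nra.
Qed.

End Admissible.

(** * Hausdorff dimension *)

Lemma exp_small c e : 0 < c -> 0 < e ->
  exists n0, forall n, (n0 <= n)%nat -> exp (- c * INR n) < e.
Proof.
  intros Hc He. destruct (exists_INR_ge (/ e / c)) as [n0 Hn0]. exists n0. intros n Hn.
  apply le_INR in Hn.
  assert (H1 : / e <= c * INR n).
  { replace (/ e) with (c * (/ e / c)) by (field; lra). apply Rmult_le_compat_l; lra. }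
  pose proof (exp_ineq1_le (c * INR n)) as H2.
  replace (- c * INR n) with (- (c * INR n)) by ring. rewrite exp_Ropp.
  rewrite <- (Rinv_inv e). assert (0 < / e) by (apply Rinv_0_lt_compat; auto).
  apply Rinv_lt_contravar; [apply Rmult_lt_0_compat; lra|lra].
Qed.

Lemma lsum_const_le {T} (l : list T) F c :
  (forall x, In x l -> F x <= c) -> lsum l F <= INR (length l) * c.
Proof.
  induction l as [|x l IH]; intros H; [simpl; lra|].
  rewrite length_cons, S_INR. simpl lsum. pose proof (H x (or_introl eq_refl)).
  assert (lsum l F <= INR (length l) * c) by (apply IH; intros; apply H; right; auto). lra.
Qed.

Lemma rsum_nth_error_le {T} (l : list T) (F : T -> R) N :
  (forall p, In p l -> 0 <= F p) ->
  rsum N (fun i => match nth_error l i with Some p => F p | None => 0 end) <= lsum l F.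
Proof.
  revert N. induction l as [|x l IH]; intros N H.
  - rewrite (rsum_ext N _ (fun _ => 0)); [rewrite rsum_const; simpl; lra|].
    intros i _. rewrite nth_error_nil. reflexivity.
  - destruct N as [|N].
    + change (0 <= lsum (x :: l) F). apply lsum_nonneg. auto.
    + rewrite rsum_S_l. simpl. apply Rplus_le_compat_l. apply IH. intros; apply H; right; auto.
Qed.

Lemma geometric_tail C c n0 K : 0 <= C -> 0 < c ->
  rsum K (fun n => indic (n0 <= n)%nat * (C * exp (- c * INR n)))
    <= C * exp (- c * INR n0) / (1 - exp (- c)).
Proof.
  intros HC Hc.
  assert (Hr : 0 < 1 - exp (- c)).
  { assert (exp (- c) < exp 0) by (apply exp_increasing; lra). rewrite exp_0 in H. lra. }
  (* The tail of the series from [max K n0] on is added to the left side, so that every induction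
     step balances. *)
  assert (Hs : rsum K (fun n => indic (n0 <= n)%nat * (C * exp (- c * INR n)))
     + C * exp (- c * INR (max K n0)) / (1 - exp (- c)) <= C * exp (- c * INR n0) / (1 - exp (- c))).
  { induction K as [|K IH]; [simpl; lra|]. simpl rsum.
    destruct (Nat.le_gt_cases n0 K) as [Hle|Hgt].
    - rewrite (indic_true (n0 <= K)%nat) by auto. rewrite Nat.max_l in IH by auto.
      rewrite Nat.max_l by lia. rewrite S_INR.
      replace (- c * (INR K + 1)) with (- c * INR K + - c) by ring. rewrite exp_plus.
      eapply Rle_trans; [|apply IH]. rewrite Rplus_assoc. apply Rplus_le_compat_l.
      apply Req_le. field. lra.
    - rewrite (indic_false (n0 <= K)%nat) by lia. rewrite Nat.max_r in * by lia. lra. }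
  assert (0 <= C * exp (- c * INR (max K n0)) / (1 - exp (- c))).
  { unfold Rdiv. apply Rmult_le_pos; [apply Rmult_le_pos; [auto|left; apply exp_pos]|].
    left. apply Rinv_0_lt_compat. auto. }
  lra.
Qed.

Lemma half_sum K : rsum K (fun i => / 8 * (/ 2) ^ S i) <= / 8.
Proof.
  rewrite rsum_scal.
  assert (rsum K (fun i => (/ 2) ^ S i) = 1 - (/ 2) ^ K).
  { induction K as [|K IH]; [simpl; ring|]. cbn [rsum]. rewrite IH. simpl. field. }
  rewrite H. assert (0 < (/ 2) ^ K) by (apply pow_lt; lra). lra.
Qed.

Lemma finite_bound (n : nat) (Q : nat -> nat -> Prop) :
  (forall a K K', (K <= K')%nat -> Q a K -> Q a K') ->
  (forall a, (a < n)%nat -> exists K, Q a K) -> exists K, forall a, (a < n)%nat -> Q a K.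
Proof.
  intros Hmono. induction n as [|n IH]; intros H; [exists 0%nat; intros; lia|].
  destruct IH as [K1 HK1]; [intros; apply H; lia|]. destruct (H n ltac:(lia)) as [K2 HK2].
  exists (max K1 K2). intros a Ha. destruct (Nat.eq_dec a n) as [->|].
  - eapply Hmono; [|exact HK2]. lia.
  - eapply Hmono; [|apply HK1; lia]. lia.
Qed.

Section Hausdorff.
Variables (m q : nat) (A : nat -> nat -> nat).
Hypothesis hm : (2 <= m)%nat.
Hypothesis hq : (2 <= q)%nat.
Hypothesis h01 : zero_one m A.

(** Compactness of X_A. If no finite part sufficed, some infinite branch would have only cylinders
    without finite cover. Its limit is either inadmissible at some length, where the claim is
    vacuous, or in X_A and then inside a given cylinder. *)
Lemma finite_subcover (ni : nat -> nat) (wi : nat -> nat -> nat) :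
  (forall x, X_A m q A x -> exists i, agree (ni i) x (wi i)) ->
  exists K N, forall x, in_Sigma m x -> adm q A N x ->
    exists i, (i < K)%nat /\ (ni i <= N)%nat /\ agree (ni i) x (wi i).
Proof.
  intros Hcov.
  (* One K bounds the number of sets, their lengths and the depth of admissibility. By monotonicity
     the m children of a word can share it. *)
  pose (C := fun n x K => forall y, in_Sigma m y -> agree n y x -> adm q A K y ->
      exists i, (i < K)%nat /\ (ni i <= K)%nat /\ agree (ni i) y (wi i)).
  assert (Cmono : forall n x K K', (K <= K')%nat -> C n x K -> C n x K').
  { intros n x K K' HK HC y Hy Hag Ha. destruct (HC y Hy Hag) as [i [H1 [H2 H3]]].
    - apply (adm_le q A K'); auto.
    - exists i. split; [lia|split; [lia|auto]]. }
  assert (Cdep : forall n x y K, agree n x y -> C n x K -> C n y K).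
  { intros n x y K Hxy HC z Hz Hag. apply HC; auto. eapply agree_trans; [eauto|].
    apply agree_sym; auto. }
  destruct (classic (exists K, C 0%nat (fun _ => O) K)) as [[K HK]|Hno].
  { exists K, K. intros x Hx Ha. apply HK; auto. intros j Hj. lia. }
  exfalso.
  destruct (infinite_branch m (fun n x => ~ exists K, C n x K)) with (n0 := 0%nat) (x0 := fun _ : nat => O)
    as [y [Hy [_ HyQ]]]; auto.
  - intros n x y Hxy HQ [K HK]. apply HQ. exists K. apply (Cdep n y); [apply agree_sym; auto|auto].
  - intros n x Hx HQ. apply NNPP. intros Hnoa. apply HQ.
    destruct (finite_bound m (fun a K => C (S n) (upd x n a) K)) as [K HK].
    + intros a K K'. apply Cmono.
    + intros a Ha. apply NNPP. intros HnK. apply Hnoa. exists a. auto.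
    + exists K. intros y Hy Hag Hadm. apply (HK (y n)); auto.
      apply agree_S. rewrite upd_eq. split; [|auto].
      eapply agree_trans; [eauto|]. apply agree_sym, agree_upd.
  - intros j. lia.
  - destruct (classic (exists n, ~ adm q A n y)) as [[n Hn]|Hall].
    + apply (HyQ n ltac:(lia)). exists n. intros z Hz Hag Ha. exfalso. apply Hn.
      apply (adm_agree q A hq n z); auto.
    + assert (HX : X_A m q A y).
      { apply X_A_adm. split; [auto|]. intros n. apply NNPP. intros Hn. apply Hall. eauto. }
      destruct (Hcov y HX) as [i Hi].
      apply (HyQ (max (ni i) (S i)) ltac:(lia)). exists (max (ni i) (S i)).
      intros z Hz Hag _. exists i. split; [lia|split; [lia|]].
      eapply agree_trans; [|exact Hi]. apply (agree_le (max (ni i) (S i))); [lia|auto].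
Qed.

(** * The Markov law on the chains and the masses of cylinders *)

Variable t : nat -> R.
Hypothesis ht : t_vec m q A t.

Definition piota (a : nat) : R := t a / rsum m t.
Definition ptau (i a : nat) : R := INR (A i a) * t a / t i ^ q.
Definition logt (i : nat) : R := ln (t i).

Local Notation T := (rsum m t).
Local Notation Ex := (wsum m q piota ptau).
Local Notation P := (wt q piota ptau).
Local Notation l := (ln (INR m)).

Lemma t_gt_1 i : (i < m)%nat -> 1 < t i.
Proof. intros Hi. apply ht. auto. Qed.

Lemma T_gt_1 : 1 < T.
Proof.
  apply Rlt_le_trans with (t 0%nat); [apply t_gt_1; lia|].
  apply (rsum_term_le m t); [|lia]. intros j Hj. pose proof (t_gt_1 j Hj). lra.
Qed.

Lemma piota_nonneg a : (a < m)%nat -> 0 <= piota a.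
Proof.
  intros Ha. pose proof T_gt_1. pose proof (t_gt_1 a Ha). apply Rlt_le, Rdiv_lt_0_compat; lra.
Qed.

Lemma ptau_nonneg i a : (i < m)%nat -> (a < m)%nat -> 0 <= ptau i a.
Proof.
  intros Hi Ha. pose proof (t_gt_1 a Ha). pose proof (t_gt_1 i Hi).
  unfold ptau, Rdiv. apply Rmult_le_pos.
  - apply Rmult_le_pos; [apply pos_INR|lra].
  - left. apply Rinv_0_lt_compat, pow_lt. lra.
Qed.

Lemma piota_sum : rsum m piota = 1.
Proof.
  pose proof T_gt_1. unfold piota. rewrite (rsum_ext m _ (fun a => / T * t a)).
  - rewrite rsum_scal. field. lra.
  - intros a _. unfold Rdiv. ring.
Qed.

Lemma ptau_sum i : (i < m)%nat -> rsum m (ptau i) = 1.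
Proof.
  intros Hi. pose proof (t_gt_1 i Hi). assert (0 < t i ^ q) by (apply pow_lt; lra).
  unfold ptau. rewrite (rsum_ext m _ (fun a => / t i ^ q * (INR (A i a) * t a))).
  - rewrite rsum_scal. destruct (ht i Hi) as [_ <-]. field. lra.
  - intros a _. unfold Rdiv. ring.
Qed.

Lemma P_pos_adm n x : in_Sigma m x -> 0 < P n x -> adm q A n x.
Proof.
  intros Hx. induction n as [|n IH]; intros Hp; [intros k Hk Hqk; nia|].
  simpl in Hp.
  pose proof (wt_nonneg m q piota ptau piota_nonneg ptau_nonneg n x Hx) as H1.
  pose proof (kern_nonneg m q piota ptau piota_nonneg ptau_nonneg x n (x n) Hx (Hx n)) as H2.
  apply adm_S; auto. split; [apply IH; nra|]. intros Hd.
  destruct (h01 (x (S n / q - 1)%nat) (x n) (Hx _) (Hx _)) as [H0|H0]; [|auto].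
  exfalso. unfold kern in Hp. rewrite (proj2 (Nat.eqb_eq _ _) Hd) in Hp. unfold ptau in Hp.
  rewrite H0 in Hp. simpl INR in Hp. unfold Rdiv in Hp. rewrite !Rmult_0_l, Rmult_0_r in Hp. lra.
Qed.

(** Each letter contributes its own t, each chain start a factor 1/T, and each letter of index at
    most n/q a factor t^-q from its one child. *)
Lemma P_formula n x : in_Sigma m x -> adm q A n x ->
  P n x = exp (- INR (hcount q n) * ln T + Ssum logt n x - INR q * Ssum logt (n / q) x).
Proof.
  intros Hx. pose proof T_gt_1 as HT. induction n as [|n IH]; intros Ha.
  - unfold hcount, Ssum. simpl. rewrite Nat.Div0.div_0_l. simpl.
    replace (-0 * ln T + 0 - INR q * 0) with 0 by ring. rewrite exp_0. reflexivity.
  - apply adm_S in Ha; [|auto]. destruct Ha as [Ha1 Ha2]. simpl wt. rewrite IH by auto.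
    pose proof (t_gt_1 (x n) (Hx n)) as Htn.
    unfold kern. destruct (Nat.eqb_spec (S n mod q) 0) as [Hd|Hd].
    + specialize (Ha2 Hd). unfold ptau. rewrite Ha2.
      rewrite hcount_S_dvd, div_S_dvd by auto. unfold Ssum. simpl rsum.
      rewrite div_S_dvd in * by auto. simpl Nat.sub. rewrite Nat.sub_0_r.
      pose proof (t_gt_1 (x (n / q)%nat) (Hx _)) as Htk.
      set (s1 := rsum n _). set (s2 := rsum (n / q) _).
      replace (- INR (hcount q n) * ln T + (s1 + logt (x n)) - INR q * (s2 + logt (x (n / q)%nat)))
       with ((- INR (hcount q n) * ln T + s1 - INR q * s2) + (logt (x n) + - (INR q * logt (x (n / q)%nat))))
       by ring.
      rewrite exp_plus, (exp_plus (logt (x n))), exp_Ropp. unfold logt.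
      rewrite <- ln_pow_nat, !exp_ln by (try apply pow_lt; lra). simpl INR. unfold Rdiv. ring.
    + rewrite hcount_S_ndvd, div_S_ndvd by auto. unfold Ssum, piota. simpl rsum. rewrite S_INR.
      set (s1 := rsum n _). set (s2 := rsum (n / q) _).
      replace (- (INR (hcount q n) + 1) * ln T + (s1 + logt (x n)) - INR q * s2)
       with ((- INR (hcount q n) * ln T + s1 - INR q * s2) + (logt (x n) + - ln T)) by ring.
      rewrite exp_plus, (exp_plus (logt (x n))), exp_Ropp. unfold logt.
      rewrite !exp_ln by lra. unfold Rdiv. ring.
Qed.

Lemma logt_bounds i : (i < m)%nat -> 0 <= logt i <= l.
Proof.
  intros Hi. pose proof (t_gt_1 i Hi). pose proof (t_le_m m q A hm h01 hq t ht i Hi). unfold logt.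
  split; [rewrite <- ln_1|]; apply ln_le_mono; lra.
Qed.

Local Notation dH := ((INR q - 1) / INR q * logm m T).

Lemma dH_ln : dH * l = (1 - / INR q) * ln T.
Proof.
  pose proof (ln_m_pos m hm). assert (2 <= INR q) by (apply (le_INR 2); auto).
  unfold logm. field. lra.
Qed.

Lemma dH_pos : 0 < dH.
Proof.
  pose proof (ln_m_pos m hm). assert (2 <= INR q) by (apply (le_INR 2); auto).
  pose proof T_gt_1. assert (0 < ln T) by (rewrite <- ln_1; apply ln_increasing; lra).
  unfold logm. apply Rmult_lt_0_compat; apply Rdiv_lt_0_compat; lra.
Qed.

Lemma hcount_pow j : INR (hcount q (q ^ S j)) = INR (q ^ S j) * (1 - / INR q).
Proof.
  assert (2 <= INR q) by (apply (le_INR 2); auto).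
  unfold hcount. rewrite Nat.pow_succ_r', Nat.mul_comm, Nat.div_mul by lia.
  rewrite minus_INR by nia. rewrite mult_INR. field. lra.
Qed.

(* The averages b_j = S_{q^j}/q^j stay in [0, ln m], so they cannot decrease by a fixed
   amount too many times in a row. *)
Lemma good_scale_exists x eps j0 J :
  in_Sigma m x -> 0 < eps -> 1 < INR J * eps ->
  exists j, (j0 <= j < j0 + J)%nat /\
    - (eps * l) * INR (q ^ S j) <= Ssum logt (q ^ S j) x - INR q * Ssum logt (q ^ j) x.
Proof.
  intros Hx He HJ. apply NNPP. intros Hno.
  pose proof (ln_m_pos m hm) as Hl. assert (Hq2 : 2 <= INR q) by (apply (le_INR 2); auto).
  assert (Hpos : forall j, 0 < INR (q ^ j)).
  { intros j. rewrite pow_INR. apply pow_lt. lra. }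
  pose (b := fun j => Ssum logt (q ^ j) x / INR (q ^ j)).
  assert (Hb : forall j, 0 <= b j <= l).
  { intros j. unfold b. specialize (Hpos j).
    assert (0 <= Ssum logt (q ^ j) x <= INR (q ^ j) * l).
    { unfold Ssum. rewrite <- rsum_const. split; [apply rsum_nonneg|apply rsum_le];
        intros k _; apply logt_bounds; auto. }
    split.
    - unfold Rdiv. apply Rmult_le_pos; [lra|]. left. apply Rinv_0_lt_compat. auto.
    - apply Rmult_le_reg_r with (INR (q ^ j)); [auto|]. unfold Rdiv.
      rewrite Rmult_assoc, Rinv_l by lra. lra. }
  assert (Hdec : forall k, (k <= J)%nat -> b (j0 + k)%nat <= b j0 - INR k * (eps * l)).
  { induction k as [|k IH]; intros Hk.
    - rewrite Nat.add_0_r. simpl. lra.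
    - specialize (IH ltac:(lia)). rewrite S_INR.
      assert (Hstep : b (S (j0 + k)) <= b (j0 + k)%nat - eps * l).
      { apply Rnot_lt_le. intros Hlt. apply Hno. exists (j0 + k)%nat. split; [lia|].
        pose proof (Hpos (S (j0 + k))) as Hp1. pose proof (Hpos (j0 + k)%nat) as Hp0.
        replace (Ssum logt (q ^ S (j0 + k)) x - INR q * Ssum logt (q ^ (j0 + k)) x)
          with ((b (S (j0 + k)) - b (j0 + k)%nat) * INR (q ^ S (j0 + k))).
        - apply Rmult_le_compat_r; lra.
        - unfold b. rewrite Nat.pow_succ_r', mult_INR in *. field. lra. }
      rewrite Nat.add_succ_r. lra. }
  specialize (Hdec J (le_n J)). pose proof (Hb j0). pose proof (Hb (j0 + J)%nat). nra.
Qed.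

Lemma pw_scale n s : pw ((/ INR m) ^ n) s = exp (- (s * l) * INR n).
Proof.
  pose proof (inv_m_pow_pos m hm n). unfold pw. destruct Req_EM_T; [lra|].
  unfold Rpower. rewrite ln_pow_nat, ln_Rinv.
  - f_equal. ring.
  - pose proof (INR_m_ge m hm). lra.
  - apply inv_m_bounds. auto.
Qed.

(** One eps is spent on the good cylinders, where P >= m^(-n (d + eps)); the other gives m^(-n s) <=
    m^(-n eps) P, so that the good words of one length n contribute at most m^(-n eps). *)
Lemma Hausdorff_upper eps : 0 < eps -> Hnull m (dH + 2 * eps) (X_A m q A).
Proof.
  intros He delta e Hdelta Hpe.
  pose proof (ln_m_pos m hm) as Hl. assert (Hq2 : 2 <= INR q) by (apply (le_INR 2); auto).
  set (s := dH + 2 * eps).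
  (* The number of consecutive scales: averages in [0, ln m] cannot fall by eps ln m at each of J
     steps once J eps > 1. *)
  destruct (exists_INR_ge (2 / eps)) as [J HJ].
  assert (HJ1 : 1 < INR J * eps).
  { assert (2 <= INR J * eps); [|lra].
    replace 2 with (2 / eps * eps) by (field; lra). apply Rmult_le_compat_r; lra. }
  assert (HJpos : 0 < INR J) by nra.
  destruct (exp_small (eps * l) (e / INR J)) as [j1 Hj1]; [nra|apply Rdiv_lt_0_compat; auto|].
  destruct (scale_exists m hm delta Hdelta) as [j2 [Hj2 _]].
  set (j0 := max j1 j2).
  assert (Hlen : forall j, (j0 <= j)%nat -> (j0 <= q ^ S j)%nat).
  { intros j Hj. pose proof (Nat.pow_gt_lin_r q (S j) ltac:(lia)). lia. }
  pose (good := fun p : nat * (nat -> nat) => exp (- ((dH + eps) * l) * INR (fst p)) <= P (fst p) (snd p)).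
  pose (Lst := flat_map (fun j => map (fun w => (q ^ S j, w)%nat) (words m (q ^ S j))) (seq j0 J)).
  assert (HLst : forall p, In p Lst -> (j0 <= fst p)%nat).
  { intros p Hp. apply in_flat_map in Hp. destruct Hp as [j [Hj Hp]]. apply in_seq in Hj.
    apply in_map_iff in Hp. destruct Hp as [w [<- _]]. apply Hlen. lia. }
  exists (fun i x => in_Sigma m x /\ exists p, nth_error Lst i = Some p /\ good p /\ agree (fst p) x (snd p)).
  (* Cylinders that are not good, and indices beyond the list, get an empty set and radius 0;
     [pw 0 s = 0] makes them free. *)
  exists (fun i => match nth_error Lst i with Some p => indic (good p) * (/ INR m) ^ fst p | None => 0 end).
  split; [|split].
  - intros i. split; [|split; [tauto|]].
    + destruct (nth_error Lst i) as [p|] eqn:Ep; [|lra].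
      apply nth_error_In in Ep. apply HLst in Ep.
      pose proof (indic_bounds (good p)). pose proof (inv_m_pow_pos m hm (fst p)).
      assert ((/ INR m) ^ fst p <= delta).
      { eapply Rle_trans; [|exact Hj2]. apply inv_m_pow_le; [auto|lia]. }
      split; nra.
    + intros x y [_ [p [Hp [Hg Hax]]]] [_ [p' [Hp' [_ Hay]]]] d Hd.
      rewrite Hp in *. injection Hp' as <-. rewrite indic_true, Rmult_1_l by auto.
      apply (cylinder_diam m hm (fun x => agree (fst p) x (snd p)) (fst p) (snd p)) with x y; auto.
  - intros x HX. apply X_A_adm in HX. destruct HX as [Hx Ha].
    destruct (good_scale_exists x eps j0 J Hx He HJ1) as [j [Hj HS]].
    destruct (words_prefix m (q ^ S j) x Hx) as [w [Hw Hag]].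
    assert (Hin : In ((q ^ S j)%nat, w) Lst).
    { apply in_flat_map. exists j. split; [apply in_seq; lia|]. apply in_map_iff. exists w. auto. }
    destruct (In_nth_error Lst _ Hin) as [i Hi]. exists i. split; [auto|].
    exists ((q ^ S j)%nat, w). split; [auto|split; [|apply agree_sym; auto]].
    unfold good. cbn [fst snd]. rewrite (wt_agree q piota ptau hq _ w x Hag), P_formula by auto.
    apply exp_mono. rewrite hcount_pow.
    rewrite (Nat.pow_succ_r' q j) at 4. rewrite (Nat.mul_comm q), Nat.div_mul by lia.
    pose proof dH_ln as HdH. set (n := INR (q ^ S j)) in *.
    replace (- ((dH + eps) * l) * n) with (- n * (dH * l) - eps * l * n) by ring.
    rewrite HdH. lra.
  - intros N. rewrite <- rsum_sum_f_R0.
    rewrite (rsum_ext (S N) _ (fun i => match nth_error Lst i with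
       Some p => indic (good p) * exp (- (s * l) * INR (fst p)) | None => 0 end)).
    2:{ intros i _. destruct (nth_error Lst i) as [p|].
        - destruct (classic (good p)) as [Hg|Hg].
          + rewrite indic_true, !Rmult_1_l by auto. apply pw_scale.
          + rewrite indic_false, !Rmult_0_l by auto. unfold pw. destruct Req_EM_T; [auto|lra].
        - unfold pw. destruct Req_EM_T; [auto|lra]. }
    eapply Rle_lt_trans;
      [apply (rsum_nth_error_le Lst (fun p => indic (good p) * exp (- (s * l) * INR (fst p))))|].
    { intros p _. apply Rmult_le_pos; [apply indic_bounds|left; apply exp_pos]. }
    unfold Lst. rewrite lsum_flat_map.
    apply Rle_lt_trans with (INR J * exp (- (eps * l) * INR j0)).
    + eapply Rle_trans; [apply (lsum_const_le (seq j0 J) _ (exp (- (eps * l) * INR j0)))|].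
      2:{ rewrite length_seq. lra. }
      intros j Hj. apply in_seq in Hj. rewrite lsum_map. cbn [fst snd].
      set (n := (q ^ S j)%nat).
      apply Rle_trans with (exp (- (eps * l) * INR n)).
      2:{ apply exp_mono. assert (INR j0 <= INR n) by (apply le_INR; apply (Hlen j); lia).
          apply Rmult_le_compat_neg_l; [|auto].
          assert (0 < eps * l) by (apply Rmult_lt_0_compat; auto). lra. }
      apply Rle_trans with (lsum (words m n) (fun w => exp (- (eps * l) * INR n) * (P n w * 1))).
      * apply lsum_le. intros w Hw. apply words_Sigma in Hw; [|lia].
        pose proof (wt_nonneg m q piota ptau piota_nonneg ptau_nonneg n w Hw) as Hp.
        pose proof (exp_pos (- (eps * l) * INR n)) as Hep.
        destruct (classic (good (n, w))) as [Hg|Hg]; [|rewrite indic_false by auto; nra].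
        rewrite indic_true by auto. unfold good in Hg. cbn [fst snd] in Hg.
        rewrite Rmult_1_l, Rmult_1_r.
        replace (- (s * l) * INR n) with (- (eps * l) * INR n + - ((dH + eps) * l) * INR n)
          by (unfold s; ring).
        rewrite exp_plus. apply Rmult_le_compat_l; lra.
      * rewrite lsum_scal.
        change (lsum (words m n) (fun w => P n w * 1)) with (Ex n (fun _ => 1)).
        rewrite wsum_one; [lra|auto|lia|apply piota_sum|apply ptau_sum].
    + specialize (Hj1 j0 ltac:(lia)).
      replace e with (INR J * (e / INR J)) by (field; lra). apply Rmult_lt_compat_l; auto.
Qed.

(** S_n and S_(n/q) concentrate around multiples of the same L, so L cancels in S_n - q S_(n/q) up
    to a rounding error of at most q |L|. *)
Lemma bad_rare eta : 0 < eta ->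
  rare m q piota ptau (fun n x => exp (- ((dH - eta) * l) * INR n) < P n x).
Proof.
  intros Heta. pose proof (ln_m_pos m hm) as Hl.
  assert (Hq2 : 2 <= INR q) by (apply (le_INR 2); auto).
  (* The budget eta l n is 4 e0 n: one part for S_n, one for q S_(n/q), two for the rounding. *)
  set (e0 := eta * l / 4). assert (He0 : 0 < e0) by (unfold e0; nra).
  destruct (concentrates_exists m q piota ptau ltac:(lia) hq piota_nonneg ptau_nonneg piota_sum ptau_sum
     logt l e0) as [L HL]; [|auto|].
  { intros a Ha. apply logt_bounds in Ha. rewrite Rabs_pos_eq; lra. }
  unfold concentrates in HL.
  destruct (exists_INR_ge (INR q * Rabs L / (2 * e0))) as [n1 Hn1].
  assert (Hm1 : (1 <= m)%nat) by lia.
  apply (rare_sub m q piota ptau) with (Q := fun n x =>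
    e0 * INR n < Rabs (Ssum logt n x - INR n * L) \/
    e0 * INR (n / q) < Rabs (Ssum logt (n / q) x - INR (n / q) * L));
    auto using piota_nonneg, ptau_nonneg.
  2:{ apply rare_or; auto using piota_nonneg, ptau_nonneg.
      apply (rare_div m q piota ptau Hm1 hq) with
        (Q := fun n x => e0 * INR n < Rabs (Ssum logt n x - INR n * L));
        auto using piota_sum, ptau_sum.
      intros n x y Hxy. rewrite (Ssum_agree _ _ _ _ Hxy). auto. }
  exists n1. intros n x Hn Hx Hp Hbig. apply NNPP. intros Hno. apply not_or_and in Hno.
  destruct Hno as [H1 H2]. apply Rnot_lt_le in H1, H2.
  apply (Rlt_not_le _ _ Hbig). rewrite P_formula by (auto; apply P_pos_adm; auto).
  apply exp_mono. apply Rabs_le_inv in H1, H2.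
  apply le_INR in Hn. pose proof (INR_div_bounds q n hq) as Hb.
  assert (Hnl : INR q * Rabs L <= 2 * e0 * INR n).
  { replace (INR q * Rabs L) with (2 * e0 * (INR q * Rabs L / (2 * e0))) by (field; lra).
    apply Rmult_le_compat_l; lra. }
  unfold hcount. rewrite minus_INR by (apply div_le_self; auto).
  pose proof dH_ln as Hd. pose proof T_gt_1 as HT.
  assert (HlT : 0 < ln T) by (rewrite <- ln_1; apply ln_increasing; lra).
  set (k := INR (n / q)) in *. set (S1 := Ssum logt n x) in *. set (S2 := Ssum logt (n / q) x) in *.
  set (Nn := INR n) in *.
  replace (- ((dH - eta) * l) * Nn) with (- Nn * (dH * l) + 4 * e0 * Nn) by (unfold e0; field; lra).
  rewrite Hd.
  assert (Hk : Nn - INR q <= INR q * k <= Nn).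
  { replace Nn with (INR q * (Nn / INR q)) by (field; lra). split; nra. }
  assert (HkL : Nn * L - INR q * k * L <= INR q * Rabs L).
  { pose proof (Rle_abs L). pose proof (Rabs_pos L).
    replace (Nn * L - INR q * k * L) with ((Nn - INR q * k) * L) by ring.
    apply Rle_trans with ((Nn - INR q * k) * Rabs L); [apply Rmult_le_compat_l; lra|].
    apply Rmult_le_compat_r; lra. }
  assert (HqS2 : INR q * (k * L - e0 * k) <= INR q * S2) by (apply Rmult_le_compat_l; lra).
  assert (He0k : INR q * k * e0 <= Nn * e0) by (apply Rmult_le_compat_r; lra).
  assert (HT2 : Nn * (1 - / INR q) * ln T <= (Nn - k) * ln T).
  { apply Rmult_le_compat_r; [lra|]. unfold Rdiv in Hb. lra. }
  lra.
Qed.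

(** With s + eta halfway between s and d, cylinders that are not bad have mass at most m^(-n s). A
    cover of small cost would bound the total mass 1 by 1/4 + 1/8 from such cylinders plus 1/2 from
    bad ones. *)
Lemma Hausdorff_lower s : 0 < s -> Hnull m s (X_A m q A) -> dH <= s.
Proof.
  intros Hs Hnull. apply Rnot_lt_le. intros Hlt.
  pose proof (ln_m_pos m hm) as Hl.
  set (eta := (dH - s) / 2). assert (Heta : 0 < eta) by (unfold eta; lra).
  destruct (bad_rare eta Heta) as (C & c & n1 & HC & Hc & Hbad).
  replace (dH - eta) with (s + eta) in Hbad by (unfold eta; lra).
  pose (bad := fun n x => exp (- ((s + eta) * l) * INR n) < P n x).
  assert (Hbad' : forall n, (n1 <= n)%nat -> Ex n (fun x => indic (bad n x)) <= C * exp (- c * INR n))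
    by exact Hbad. clear Hbad.
  assert (bad_agree : forall n x y, agree n x y -> bad n x -> bad n y).
  { intros n x y Hxy. unfold bad. rewrite (wt_agree q piota ptau hq n x y Hxy). auto. }
  assert (Hr : 0 < 1 - exp (- c)).
  { assert (exp (- c) < exp 0) by (apply exp_increasing; lra). rewrite exp_0 in H. lra. }
  destruct (exp_small c ((1 - exp (- c)) / (2 * (C + 1)))) as [n2 Hn2]; [auto|apply Rdiv_lt_0_compat; lra|].
  set (n0 := max n1 n2).
  assert (Htail : C * exp (- c * INR n0) / (1 - exp (- c)) <= / 2).
  { specialize (Hn2 n0 ltac:(lia)). apply Rmult_le_reg_r with (1 - exp (- c)); [auto|].
    unfold Rdiv. rewrite Rmult_assoc, Rinv_l, Rmult_1_r by lra.
    apply Rle_trans with (C * ((1 - exp (- c)) / (2 * (C + 1)))); [apply Rmult_le_compat_l; lra|].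
    replace (C * ((1 - exp (- c)) / (2 * (C + 1)))) with
      (/ 2 * (1 - exp (- c)) * (C / (C + 1))) by (field; lra).
    assert (C / (C + 1) <= 1).
    { apply Rmult_le_reg_r with (C + 1); [lra|]. unfold Rdiv. rewrite Rmult_assoc, Rinv_l by lra. lra. }
    assert (0 <= / 2 * (1 - exp (- c))) by lra. nra. }
  destruct (Hnull ((/ INR m) ^ n0) (/ 4) (inv_m_pow_pos m hm n0) ltac:(lra)) as (U & r & HU & Hcov & Hsum).
  (* Each [U i] is put in a cylinder of length at least n0. A set with [r i = 0] has no first scale
     and costs 0, so it receives a long cylinder paid for by a slack that sums to at most 1/8. *)
  assert (Hcyl : forall i, exists nw : nat * (nat -> nat),
     (n0 <= fst nw)%nat /\ in_Sigma m (snd nw) /\ (forall x, U i x -> agree (fst nw) x (snd nw)) /\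
     exp (- (s * l) * INR (fst nw)) <= pw (r i) s + / 8 * (/ 2) ^ S i).
  { intros i. destruct (HU i) as [Hri [HUs HUd]].
    assert (Hhalf : 0 < / 8 * (/ 2) ^ S i) by (apply Rmult_lt_0_compat; [lra|apply pow_lt; lra]).
    assert (Hn : exists n, (n0 <= n)%nat /\ (forall j, (j < n)%nat -> r i < (/ INR m) ^ j) /\
       exp (- (s * l) * INR n) <= pw (r i) s + / 8 * (/ 2) ^ S i).
    { destruct (Req_dec (r i) 0) as [Hr0|Hr0].
      - destruct (exp_small (s * l) (/ 8 * (/ 2) ^ S i)) as [n3 Hn3]; [nra|auto|].
        exists (max n0 n3). split; [lia|split].
        + intros j _. rewrite Hr0. apply inv_m_pow_pos. auto.
        + specialize (Hn3 (max n0 n3) ltac:(lia)). unfold pw. destruct Req_EM_T; [lra|contradiction].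
      - destruct (scale_exists m hm (r i)) as [n [Hn1 Hn3]]; [lra|].
        exists n. split; [|split; [auto|]].
        + apply Nat.nlt_ge. intros Hlt'.
          pose proof (inv_m_pow_le m hm (S n) n0 ltac:(lia)) as H1. simpl in H1.
          pose proof (inv_m_pow_pos m hm n). pose proof (inv_m_bounds m hm). nra.
        + rewrite <- pw_scale.
          assert (pw ((/ INR m) ^ n) s <= pw (r i) s); [|lra].
          pose proof (inv_m_pow_pos m hm n).
          unfold pw. destruct Req_EM_T; [lra|]. destruct Req_EM_T; [contradiction|].
          apply Rle_Rpower_l; lra. }
    destruct Hn as [n [Hn0 [Hnr Hns]]].
    destruct (classic (exists y, U i y)) as [[y Hy]|Hno].
    - exists (n, y). split; [auto|split; [apply HUs; auto|split; [|auto]]].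
      intros x Hx. apply (diam_agree m (U i) (r i)); auto.
    - exists (n, fun _ => O). split; [auto|split; [intros j; simpl; lia|split; [|auto]]].
      intros x Hx. exfalso. eauto. }
  pose (nw := fun i => proj1_sig (constructive_indefinite_description _ (Hcyl i))).
  assert (Hnw : forall i, (n0 <= fst (nw i))%nat /\ in_Sigma m (snd (nw i)) /\
     (forall x, U i x -> agree (fst (nw i)) x (snd (nw i))) /\
     exp (- (s * l) * INR (fst (nw i))) <= pw (r i) s + / 8 * (/ 2) ^ S i).
  { intros i. exact (proj2_sig (constructive_indefinite_description _ (Hcyl i))). }
  clearbody nw.
  destruct (finite_subcover (fun i => fst (nw i)) (fun i => snd (nw i))) as [K [N HKN]].
  { intros x Hx. destruct (Hcov x Hx) as [i Hi]. exists i. apply Hnw. auto. }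
  assert (Hm1 : (1 <= m)%nat) by lia.
  (* Union bound at the common length N: a word of positive weight lies in a cylinder of the
     subcover, and its prefix of that length is either not bad, or bad at a length between n0 and
     N. *)
  assert (Hmass : Ex N (fun _ => 1) <=
    Ex N (fun x => rsum K (fun i => indic ((fst (nw i) <= N)%nat /\
        agree (fst (nw i)) x (snd (nw i)) /\ ~ bad (fst (nw i)) x))
      + rsum (S N) (fun n => indic ((n0 <= n)%nat /\ bad n x)))).
  { apply wsum_le_pos; [auto|exact piota_nonneg|exact ptau_nonneg|]. intros x Hx Hp.
    destruct (HKN x Hx (P_pos_adm N x Hx Hp)) as [i [Hi [HiN Hag]]].
    set (F := fun i => indic ((fst (nw i) <= N)%nat /\
      agree (fst (nw i)) x (snd (nw i)) /\ ~ bad (fst (nw i)) x)).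
    set (G := fun n => indic ((n0 <= n)%nat /\ bad n x)).
    assert (HF : forall j, 0 <= F j) by (intros; apply indic_bounds).
    assert (HG : forall j, 0 <= G j) by (intros; apply indic_bounds).
    assert (0 <= rsum K F) by (apply rsum_nonneg; auto).
    assert (0 <= rsum (S N) G) by (apply rsum_nonneg; auto).
    destruct (classic (bad (fst (nw i)) x)) as [Hb|Hb].
    - assert (G (fst (nw i)) <= rsum (S N) G) by (apply rsum_term_le; [auto|lia]).
      unfold G at 1 in H1. rewrite indic_true in H1; [lra|]. split; [apply Hnw|auto].
    - assert (F i <= rsum K F) by (apply rsum_term_le; auto).
      unfold F at 1 in H1. rewrite indic_true in H1; [lra|]. auto. }
  rewrite wsum_one, wsum_plus, !wsum_rsum in Hmass by (auto using piota_sum, ptau_sum).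
  assert (H1 : rsum K (fun i => Ex N (fun x => indic ((fst (nw i) <= N)%nat /\
      agree (fst (nw i)) x (snd (nw i)) /\ ~ bad (fst (nw i)) x))) <= / 4 + / 8).
  { apply Rle_trans with (rsum K (fun i => pw (r i) s + / 8 * (/ 2) ^ S i)).
    - apply rsum_le. intros i _. destruct (Hnw i) as [_ [Hws [_ Hle]]].
      eapply Rle_trans; [|exact Hle]. set (n := fst (nw i)) in *. set (w := snd (nw i)) in *.
      destruct (classic ((n <= N)%nat /\ ~ bad n w)) as [[HnN Hgood]|Hno].
      + apply Rle_trans with (Ex N (fun x => indic (agree n x w))).
        { apply wsum_le; [auto|exact piota_nonneg|exact ptau_nonneg|]. intros x _. apply indic_le. tauto. }
        rewrite (wsum_prefix m q piota ptau hq Hm1 piota_sum ptau_sum n N); [|..].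
        * eapply Rle_trans; [apply wsum_cylinder; auto using piota_nonneg, ptau_nonneg|].
          unfold bad in Hgood. apply Rnot_lt_le in Hgood. eapply Rle_trans; [exact Hgood|].
          apply exp_mono. assert (0 <= eta * l * INR n); [|lra].
          apply Rmult_le_pos; [apply Rmult_le_pos; lra|apply pos_INR].
        * intros x y Hxy. apply indic_iff. split; intros H; eapply agree_trans; eauto using agree_sym.
        * auto.
      + apply Rle_trans with (Ex N (fun _ => 0 * 1)).
        * apply wsum_le; [auto|exact piota_nonneg|exact ptau_nonneg|]. intros x _.
          rewrite indic_false; [lra|]. intros [HnN [Hag Hg]]. apply Hno. split; [auto|].
          intros Hb. apply Hg. apply (bad_agree n w); [apply agree_sym; auto|auto].
        * rewrite wsum_scal, Rmult_0_l. left. apply exp_pos.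
    - rewrite rsum_plus. pose proof (half_sum K).
      assert (rsum K (fun i => pw (r i) s) <= / 4); [|lra].
      destruct K as [|K]; [simpl; lra|]. rewrite rsum_sum_f_R0. left. apply Hsum. }
  assert (H2 : rsum (S N) (fun n => Ex N (fun x => indic ((n0 <= n)%nat /\ bad n x))) <= / 2).
  { eapply Rle_trans; [|exact Htail]. eapply Rle_trans; [|apply (geometric_tail C c n0 (S N)); auto].
    apply rsum_le. intros n Hn. destruct (Nat.le_gt_cases n0 n) as [Hle|Hgt].
    - rewrite (indic_true (n0 <= n)%nat), Rmult_1_l by auto.
      eapply Rle_trans; [|apply (Hbad' n ltac:(lia))].
      rewrite (wsum_prefix m q piota ptau hq Hm1 piota_sum ptau_sum n N).
      + apply wsum_le; [auto|exact piota_nonneg|exact ptau_nonneg|]. intros x _. apply indic_le. tauto.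
      + intros x y Hxy. apply indic_iff.
        split; intros [Ha Hb]; (split; [auto|]); eapply bad_agree; eauto using agree_sym.
      + lia.
    - rewrite (indic_false (n0 <= n)%nat), Rmult_0_l by lia.
      apply Rle_trans with (Ex N (fun _ => 0 * 1)).
      + apply wsum_le; [auto|exact piota_nonneg|exact ptau_nonneg|]. intros x _.
        rewrite indic_false; [lra|]. lia.
      + rewrite wsum_scal. lra. }
  lra.
Qed.

Lemma Hausdorff_X_A : HausdorffDim m (X_A m q A) dH.
Proof.
  split; [intros s Hs HN; apply Hausdorff_lower; auto|].
  intros e He. pose proof dH_pos. exists (dH + 2 * (e / 4)).
  split; [lra|split; [apply Hausdorff_upper; lra|lra]].
Qed.

End Hausdorff.

(** * Uniqueness of both dimensions and conclusion *)

Lemma HausdorffDim_unique m X d d' : HausdorffDim m X d -> HausdorffDim m X d' -> d = d'.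
Proof.
  assert (H : forall d d', HausdorffDim m X d -> HausdorffDim m X d' -> d <= d').
  { clear. intros d d' [H _] [_ H']. apply Rnot_lt_le. intros Hlt.
    destruct (H' (d - d') ltac:(lra)) as [s [Hs [HN Hlt']]]. specialize (H s Hs HN). lra. }
  intros. apply Rle_antisym; auto.
Qed.

Lemma MinkowskiDim_unique m X d d' : MinkowskiDim m X d -> MinkowskiDim m X d' -> d = d'.
Proof.
  intros H H'. destruct (Req_dec d d') as [|Hne]; [auto|exfalso].
  assert (Hp : 0 < Rabs (d - d') / 2).
  { assert (0 < Rabs (d - d')) by (apply Rabs_pos_lt; lra). lra. }
  destruct (H _ Hp) as [e1 [He1 H1]]. destruct (H' _ Hp) as [e2 [He2 H2]].
  set (delta := Rmin e1 e2 / 2).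
  assert (0 < Rmin e1 e2) by (apply Rmin_glb_lt; auto).
  pose proof (Rmin_l e1 e2). pose proof (Rmin_r e1 e2).
  destruct (H1 delta ltac:(unfold delta; lra)) as [k1 [[Hk1 Hk1'] Hd1]].
  destruct (H2 delta ltac:(unfold delta; lra)) as [k2 [[Hk2 Hk2'] Hd2]].
  assert (k1 = k2) as <- by (apply Nat.le_antisymm; auto).
  set (z := ln (INR k1) / - ln delta) in *.
  assert (Rabs (d - d') <= Rabs (d - z) + Rabs (z - d')).
  { replace (d - d') with ((d - z) + (z - d')) by ring. apply Rabs_triang. }
  rewrite (Rabs_minus_sym d z) in *. lra.
Qed.

Theorem theorem1p3 (m q : nat) (A : nat -> nat -> nat)
  (hm : (2 <= m)%nat) (hq : (2 <= q)%nat)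
  (h01 : zero_one m A) (hprim : primitive_mx m A) :
  (* (i) *)
  (exists t : nat -> R,
     t_vec m q A t /\
     (forall t' : nat -> R, t_vec m q A t' -> forall i, (i < m)%nat -> t' i = t i) /\
     HausdorffDim m (X_A m q A)
       ((INR q - 1) / INR q * logm m (rsum m t))) /\
  (* (ii) *)
  (exists S : R,
     infinite_sum (fun n => logm m (INR (ones_form m A n)) / INR q ^ (n + 2)) S /\
     MinkowskiDim m (X_A m q A) ((INR q - 1) ^ 2 * S) /\
     forall dH dM, HausdorffDim m (X_A m q A) dH -> MinkowskiDim m (X_A m q A) dM ->
       (dH = dM <->
        exists lam : R, forall i, (i < m)%nat ->
          rsum m (fun j => INR (A i j) * 1) = lam * 1)).
Proof.
  destruct (t_vec_exists m q A hm h01 hprim hq) as [t ht].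
  pose proof (Hausdorff_X_A m q A hm hq h01 t ht) as HH.
  split.
  { exists t. split; [auto|split; [|auto]]. intros t' ht'.
    apply (t_vec_unique m q A hm h01 hq); auto. }
  destruct (series_cv m q A hm h01 hprim hq) as [S HS].
  pose proof (Minkowski_X_A m q A hq hm h01 hprim S HS) as HM.
  pose proof (ln_m_pos m hm) as Hl. assert (Hq2 : 2 <= INR q) by (apply (le_INR 2); auto).
  exists (S / ln (INR m)). split; [|split; [auto|]].
  - pose proof (CV_mult _ _ _ _ HS (Un_cv_const (/ ln (INR m)))) as HS'.
    intros e He. destruct (HS' e He) as [N HN]. exists N. intros n Hn. specialize (HN n Hn).
    cbv beta in HN. rewrite Rmult_comm, scal_sum in HN. erewrite sum_eq; [exact HN|].
    intros k _. unfold logm, asum, Rdiv. ring.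
  - intros dH dM H1 H2.
    rewrite (HausdorffDim_unique _ _ _ _ H1 HH), (MinkowskiDim_unique _ _ _ _ H2 HM).
    rewrite <- (dims_eq_iff m q A hm h01 hprim hq t ht S HS). unfold logm.
    set (w := ln (rsum m t)). set (l := ln (INR m)) in *.
    (* The difference of the dimensions is a positive multiple of the difference of the two sides in
       [dims_eq_iff]. *)
    assert (Hw : (INR q - 1) / INR q * (w / l) - (INR q - 1) ^ 2 * (S / l) =
       (w - INR q * (INR q - 1) * S) * ((INR q - 1) / (INR q * l))) by (field; lra).
    assert (Hc : 0 < (INR q - 1) / (INR q * l)).
    { apply Rdiv_lt_0_compat; [lra|]. apply Rmult_lt_0_compat; lra. }
    split; intros Heq.
    + rewrite Heq, Rminus_diag in Hw. symmetry in Hw. apply Rmult_integral in Hw.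
      destruct Hw; lra.
    + apply Rminus_diag_uniq. rewrite Hw, Heq. ring.
Qed.
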